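(* Let $r\geq 4$ and let $\mathcal{H}$ be an $(r-2)$-reducible $r$-tree with $\sigma(\mathcal{H})=t+1$. Let $E_1,\dots,E_m$ be a tree-defining ordering of $\mathcal{H}$ and $S$ a minimum cross-cut of $\mathcal{H}$. Let $w$ be the vertex of $S$ that is included last in this ordering (i.e. the vertex of $S$ whose first containing edge has the largest index), and let $\mathcal{H}_w$ be the subgraph of $\mathcal{H}$ consisting of all edges containing $w$. Suppose $\mathcal{H}_w$ is the linear star $\mathcal{L}^r_p$. Then there is a positive integer $n_1$ such that for all $n\geq n_1$, $$\mathrm{ex}(n,\mathcal{H})\leq\binom{n}{r}-\binom{n-t}{r}+\mathrm{ex}(n-t,\mathcal{L}^r_p).$$
   Context: An $r$-tree is an $r$-uniform hypergraph whose edges can be ordered $E_1,\dots,E_m$ (a tree-defining ordering) so that for each $i>1$ there is $\alpha(i)<i$ with $E_i\cap\bigcup_{j<i}E_j\subseteq E_{\alpha(i)}$. It is $k$-reducible if each edge contains at least $k$ vertices of degree $1$. A cross-cut is a vertex set meeting each edge in exactly one vertex; $\sigma(\mathcal{H})$ is the minimum size of a cross-cut, and a minimum cross-cut is one of that size. $\mathcal{L}^r_p$ is the $r$-uniform linear star: $p$ edges of size $r$ pairwise intersecting in exactly one common vertex. $\mathrm{ex}(n,\mathcal{G})$ is the maximum number of edges of an $n$-vertex $r$-uniform hypergraph not containing $\mathcal{G}$. *)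

(* Defs.v *)
From mathcomp Require Import all_boot.

Set Implicit Arguments.
Unset Strict Implicit.
Unset Printing Implicit Defensive.

(* A hypergraph on the vertex type V is given by its set of edges
   H : {set {set V}}. *)

Definition uniform (r : nat) (V : finType) (H : {set {set V}}) : bool :=
  [forall E in H, #|E| == r].

Definition edges_at (V : finType) (H : {set {set V}}) (v : V) :
    {set {set V}} :=
  [set E in H | v \in E].

Definition degree (V : finType) (H : {set {set V}}) (v : V) : nat :=
  #|edges_at H v|.

(* Indices start at 0, so the condition on E_i, i > 1, bears on positive i. *)
Definition tree_ordering (V : finType) (H : {set {set V}})
    (s : seq {set V}) : Prop :=
  [/\ uniq s, s =i H &
      forall i, 0 < i -> i < size s ->
        exists2 a, a < i &
          nth set0 s i :&: \bigcup_(j < i) nth set0 s j \subset nth set0 s a].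

Definition is_rtree (r : nat) (V : finType) (H : {set {set V}}) : Prop :=
  uniform r H /\ exists s, tree_ordering H s.

Definition reducible (k : nat) (V : finType) (H : {set {set V}}) : Prop :=
  forall E, E \in H -> k <= #|[set v in E | degree H v == 1]|.

Definition cross_cut (V : finType) (H : {set {set V}}) (S : {set V}) : bool :=
  [forall E in H, #|S :&: E| == 1].

(* The default value #|V| never lowers the minimum; it is the junk value of
   sigma H when H has no cross-cut. *)
Definition sigma (V : finType) (H : {set {set V}}) : nat :=
  \big[minn/#|V|]_(S : {set V} | cross_cut H S) #|S|.

Definition min_cross_cut (V : finType) (H : {set {set V}}) (S : {set V}) :
    bool :=
  cross_cut H S && (#|S| == sigma H).

Definition first_index (V : finType) (s : seq {set V}) (v : V) : nat :=
  find (fun E : {set V} => v \in E) s.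

Definition included_last (V : finType) (s : seq {set V}) (S : {set V})
    (w : V) : Prop :=
  w \in S /\ forall v, v \in S -> first_index s v <= first_index s w.

(* None is the center; the other vertices of the i-th edge are the
   Some (i, j), j < r - 1. *)
Definition linear_star (r p : nat) : {set {set option ('I_p * 'I_r.-1)}} :=
  [set None |: [set Some (i, j) | j : 'I_r.-1] | i : 'I_p].

(* H is G up to renaming of vertices; vertices of H lying in no edge are
   disregarded. *)
Definition is_copy (W V : finType) (G : {set {set W}}) (H : {set {set V}}) :
    Prop :=
  exists2 f : W -> V, injective f & H = [set f @: E | E : {set W} in G].

Definition contains (W V : finType) (G : {set {set W}}) (F : {set {set V}}) :
    bool :=
  [exists f : {ffun W -> V}, injectiveb f && [forall E in G, f @: E \in F]].

Definition ex_turan (r n : nat) (W : finType) (G : {set {set W}}) : nat :=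
  \max_(F : {set {set 'I_n}} | uniform r F && ~~ contains G F) #|F|.

(* Main.v *)
Require Import Defs.
From mathcomp Require Import all_boot perm zify.

(* Write r = k + 1 and let F be an H-free r-graph on n vertices.

   Call a pair of vertices a kernel of F if, whatever bounded set is forbidden,
   some edge of F contains the pair and avoids the set outside of it. Since H is
   (r-2)-reducible, it embeds greedily as soon as the graph of kernel pairs has
   a subgraph of large minimum degree, so F has O(n) kernel pairs. Let W be the
   bounded set of vertices lying in linearly many kernel pairs. If a positive
   proportion of n^k edges missed W, a Fueredi-type refinement would give many
   ordered edges whose kernels sit in the same positions; these positions are
   closed under intersection and include two pairs, and then the bounds on kernel
   pairs leave room for o(n^k) edges only. Hence almost all edges meet W.

   Now suppose |F| >= C(n,r) - C(n-t,r). A k-set outside W is joined to at most t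
   points of W with few exceptions, so almost every k-set is joined to some
   t-subset of W. Two t-sets cannot share a pair of vertices in the (cleaned)
   families of k-sets joined to them: H would embed with its star at w attached
   along that pair. Changing a k-tuple one coordinate at a time, one t-set T is
   joined to almost all k-sets, that is, only M = o(n^k) of the r-sets meeting T
   are missing from F.

   Finally, w being last in the ordering, the edges avoiding w meet the star at w
   inside a single one of its edges, in at most two vertices. So a star L_p in
   F - T extends to H unless every usable pair in that edge lies in too many
   missing sets. The edges of F - T with a good pair thus form an L_p-free
   family. The others have only bad pairs, and there are O(M / n^(k-2)) bad
   pairs; the shadow of an H-free family has at least a constant times as many
   members as the family, and counting triangles of bad pairs (k >= 3) shows that
   there are at most M such edges, which the M missing sets compensate. *)

Set Implicit Arguments.
Unset Strict Implicit.
Unset Printing Implicit Defensive.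

(** * Embedding trees into families with large shadow degrees *)

Lemma fiber_bound (T Q : finType) (Z : {set T}) (f : T -> Q) (B : {set Q}) m :
  (forall z, z \in Z -> f z \in B) ->
  (forall q, q \in B -> #|[set z in Z | f z == q]| <= m) ->
  #|Z| <= #|B| * m.
Proof.
move=> fB fm.
rewrite -sum1_card (partition_big f (mem B)) //=.
rewrite -sum_nat_const; apply: leq_sum => q qB.
apply: leq_trans (fm q qB); rewrite -sum1_card.
by apply: eq_leq; apply: eq_bigl => z; rewrite inE.
Qed.

Lemma exists_notin (X : finType) (A B : {set X}) :
  #|B| < #|A| -> exists2 x, x \in A & x \notin B.
Proof.
move=> lt; have /subsetPn[x xA xB] : ~~ (A \subset B).
  by apply: contraTN lt => /subset_leq_card; rewrite -leqNgt.
by exists x.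
Qed.

(** Greedy extension, one vertex of [D] at a time. With [C] empty it merely produces an injection of
    [D] into [D'], and [phi] is then a dummy. *)
Lemma ext_inj (V X : finType) (C D : {set V}) (D' : {set X}) (phi : V -> X) :
  C \subset D -> #|D| <= #|D'| -> {in C &, injective phi} ->
  phi @: C \subset D' ->
  exists f : V -> X, [/\ {in C, f =1 phi}, {in D &, injective f} &
    f @: D \subset D'].
Proof.
elim: {C}#|D :\: C| {-2}C (leqnn #|D :\: C|) phi => [|n IH] C.
  rewrite leqn0 cards_eq0 setD_eq0 => sDC phi sCD _ inj sub.
  have -> : D = C by apply/eqP; rewrite eqEsubset sDC.
  by exists phi.
move=> le phi sCD leD inj sub.
have [/eqP DC|] := boolP (C == D); first by exists phi; rewrite -?DC.
rewrite eqEsubset sCD /= => /subsetPn[d dD dC].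
have [|x xD' xC] := @exists_notin _ D' (phi @: C).
  rewrite card_in_imset //; apply: leq_trans leD; apply: proper_card.
  by apply/properP; split=> //; exists d.
pose psi v := if v == d then x else phi v.
have psiC : {in C, psi =1 phi}.
  by move=> v vC; rewrite /psi; case: eqP => // e; rewrite -e vC in dC.
have psid : psi d = x by rewrite /psi eqxx.
have [||||f [f1 f2 f3]] := IH (d |: C) _ psi _ leD.
- rewrite -ltnS; apply: leq_trans le; apply: proper_card; apply/properP; split.
    by apply: setDS; rewrite subsetUr.
  by exists d; rewrite !inE ?dC ?eqxx.
- by rewrite subUset sub1set dD.
- move=> u v /setU1P[->|uC] /setU1P[->|vC] //.
  + rewrite psid psiC // => e; case/negP: xC; rewrite e; exact: imset_f.
  + rewrite psid psiC // => e; case/negP: xC; rewrite -e; exact: imset_f.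
  + by rewrite !psiC //; apply: inj.
- apply/subsetP => _ /imsetP[v /setU1P[->|vC] ->]; first by rewrite psid.
  rewrite psiC //; apply: (subsetP sub); exact: imset_f.
exists f; split=> // v vC; rewrite f1 ?psiC // !inE vC orbT //.
Qed.

(** Every $(k-1)$-set of the shadow has codegree above [N]. A [b] inside [E :\ a] never counts,
    since the resulting set has fewer than $k$ elements. *)
Definition clean (N k : nat) (X : finType) (A : {set {set X}}) : Prop :=
  (forall E, E \in A -> #|E| = k) /\
  (forall E a, E \in A -> a \in E -> N < #|[set b | b |: E :\ a \in A]|).

(** The vertices of [E] that lie in [Y] but not in [C] are exchanged one at a time: a new vertex has
    to avoid [Y] and [E], which excludes at most [#|Y| + k <= N] of more than [N] candidates. *)
Lemma refresh N k (X : finType) (A : {set {set X}}) (E C Y : {set X}) :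
  clean N k A -> #|Y| + k <= N -> E \in A -> C \subset E ->
  exists2 E', E' \in A & C \subset E' /\ [disjoint E' :\: C & Y].
Proof.
case=> unif deg leN.
elim: {E}#|(E :\: C) :&: Y| {-2}E (leqnn #|(E :\: C) :&: Y|) => [|n IH] E.
  rewrite leqn0 cards_eq0 => /eqP e EA sCE; exists E => //; split=> //.
  by rewrite -setI_eq0 e.
move=> le EA sCE.
have [e|/set0Pn[a /setIP[/setDP[aE aC] aY]]] := eqVneq ((E :\: C) :&: Y) set0.
  by exists E => //; split=> //; rewrite -setI_eq0 e.
have [|b] := @exists_notin _ [set b | b |: E :\ a \in A] (Y :|: E).
  apply: leq_ltn_trans (deg E a EA aE); apply: leq_trans leN.
  by rewrite cardsU -(unif E EA); apply: leq_subr.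
rewrite inE !in_setU negb_or => bA /andP[bY bE].
apply: (IH (b |: E :\ a)) => //.
  rewrite -ltnS; apply: leq_trans le; apply: proper_card; apply/properP; split.
    apply/subsetP => z; rewrite !inE => /andP[/andP[zC /orP[/eqP->|/andP[_ zE]]] zY].
      by rewrite (negPf bY) in zY.
    by rewrite zC zE zY.
  exists a; rewrite !inE ?aC ?aE ?aY //= eqxx /= orbF.
  apply/negP => /andP[/eqP e _]; by rewrite -e aE in bE.
apply/subsetP => z zC; rewrite !inE (subsetP sCE) // andbT; apply/orP; right.
by apply: contraNneq aC => <-.
Qed.

Definition cover_seq (V : finType) (s : seq {set V}) : {set V} :=
  \bigcup_(E <- s) E.

Lemma cover_seqP (V : finType) (s : seq {set V}) v :
  reflect (exists2 E, E \in s & v \in E) (v \in cover_seq s).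
Proof.
rewrite /cover_seq; elim: s => [|E s IH].
  by rewrite big_nil inE; apply: (iffP idP) => // -[].
rewrite big_cons inE; apply: (iffP orP) => [[vE|/IH[D Ds vD]]|[D]].
- by exists E; rewrite ?mem_head.
- by exists D; rewrite // inE Ds orbT.
- rewrite inE => /orP[/eqP-> ->|Ds vD]; first by left.
  by right; apply/IH; exists D.
Qed.

(* The edges are listed in reverse: the head of the list is the last edge of
   the tree-defining ordering. *)
Fixpoint tree_seq (V : finType) (s : seq {set V}) : Prop :=
  if s is E :: s' then
    tree_seq s' /\ (s' = [::] \/
                    exists2 E', E' \in s' & E :&: cover_seq s' \subset E')
  else True.

Definition embeds (V X : finType) (f : V -> X) (s : seq {set V})
    (A : {set {set X}}) : Prop :=
  {in cover_seq s &, injective f} /\ (forall E, E \in s -> f @: E \in A).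

Lemma card_imset_in (V X : finType) (f : V -> X) (A : {set V}) (B : {set X}) :
  {in A &, injective f} -> f @: A \subset B -> #|A| = #|B| -> f @: A = B.
Proof.
by move=> inj sub e; apply/eqP; rewrite eqEcard sub card_in_imset // e leqnn.
Qed.

(** One step of the walk through the tree: [E'] is glued to the placed edge [E] along [E :&: E'],
    and [refresh] supplies new images for its other vertices. *)
Lemma swap_edge N k (V X : finType) (A : {set {set X}}) (E E' : {set V})
    (psi : V -> X) (Y : {set X}) :
  clean N k A -> #|Y| + k + k <= N -> #|E| = k -> #|E'| = k ->
  {in E &, injective psi} -> psi @: E \in A ->
  exists psi' : V -> X,
    [/\ {in E :&: E', psi' =1 psi}, {in E' &, injective psi'},
        psi' @: E' \in A &
        forall v, v \in E' -> v \notin E ->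
          (psi' v \notin Y) && (psi' v \notin psi @: E)].
Proof.
move=> cA leN cE cE' inj psiA.
have [||D DA [sD dD]] := @refresh N k X A (psi @: E) (psi @: (E :&: E'))
  (Y :|: psi @: E) cA _ psiA _.
- apply: leq_trans leN; rewrite leq_add2r cardsU card_in_imset // cE.
  exact: leq_subr.
- by apply: imsetS; apply: subsetIl.
have [||psi' [f1 f2 f3]] := @ext_inj V X (E :&: E') E' D psi (subsetIr _ _) _ _ sD.
- by rewrite cE' cA.1.
- by move=> u v /setIP[uE _] /setIP[vE _]; apply: inj.
exists psi'; split=> //.
  by rewrite (card_imset_in f2 f3) // cE' cA.1.
move=> v vE' vE; rewrite -negb_or -in_setU.
apply/negbT/(disjointFr dD); rewrite inE (subsetP f3) ?imset_f // andbT.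
apply/negP => /imsetP[u uEE' e].
have uE' : u \in E' by case/setIP: uEE'.
rewrite -f1 // in e; move: (f2 _ _ vE' uE' e) => evu.
by case/setIP: uEE'; rewrite -evu (negPf vE).
Qed.

(* Rerooting: the prescribed edge E0 may be any edge of the tree. If it is the
   last edge E, then E is first moved to a neighbour, and the induction
   hypothesis is rooted there. *)
Lemma tree_embedding N k (V X : finType) (A : {set {set X}}) (s : seq {set V})
    (E0 : {set V}) (phi : V -> X) (Y : {set X}) :
  clean N k A -> tree_seq s -> (forall E, E \in s -> #|E| = k) -> E0 \in s ->
  {in E0 &, injective phi} -> phi @: E0 \in A -> [disjoint phi @: E0 & Y] ->
  #|Y| + #|V| * (size s).+1 <= N ->
  exists f : V -> X, [/\ {in E0, f =1 phi}, embeds f s A &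
    [disjoint f @: cover_seq s & Y]].
Proof.
move=> cA; elim: s E0 phi Y => [//|E s IH] E0 phi Y tE unif E0s inj phiA dY leN.
have cov : cover_seq (E :: s) = E :|: cover_seq s.
  by rewrite /cover_seq big_cons.
have cE : #|E| = k by apply: unif; rewrite mem_head.
have kV : k <= #|V| by rewrite -cE max_card.
case: tE => ts [s0|[E' E's sE']].
  move: E0s; rewrite s0 inE => /eqP e0; subst E0 s.
  exists phi; split=> //.
    rewrite /embeds cov /cover_seq big_nil setU0; split=> // D.
    by rewrite inE => /eqP->.
  by rewrite cov /cover_seq big_nil setU0.
have unifs D : D \in s -> #|D| = k by move=> Ds; apply: unif; rewrite inE Ds orbT.
have cE' := unifs _ E's.
have EE' : E :&: cover_seq s = E :&: E'.
  apply/eqP; rewrite eqEsubset; apply/andP; split.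
    by rewrite subsetI subsetIl.
  apply: setIS; apply/subsetP => v vE'; apply/cover_seqP; by exists E'.
have E'cov : E' \subset cover_seq s.
  by apply/subsetP => v vE'; apply/cover_seqP; exists E'.
have size_s : 0 < size s by case: (s) E's.
have [E0s'|] := boolP (E0 \in s).
  have [|f [f1 [f2 f3] f4]] := IH E0 phi Y ts unifs E0s' inj phiA dY.
    by apply: leq_trans leN; rewrite leq_add2l leq_mul2l /= ltnS leqnSn orbT.
  have injE' : {in E' &, injective f}.
    by move=> u v uE vE; apply: f2; apply: (subsetP E'cov).
  (* The root lies among the earlier edges, so [E] is hung last on its parent [E'], away from all
     that is already embedded. *)
  have [|psi [p1 p2 p3 p4]] :=
    @swap_edge N k V X A E' E f (Y :|: f @: cover_seq s) cA _ cE' cE injE' (f3 _ E's).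
    have : #|f @: cover_seq s| <= #|V| by apply: leq_trans (leq_imset_card _ _) (max_card _).
    have : #|Y :|: f @: cover_seq s| <= #|Y| + #|f @: cover_seq s| by rewrite cardsU leq_subr.
    have : #|V| * 3 <= #|V| * (size s).+2 by rewrite leq_mul2l !ltnS size_s orbT.
    move: leN kV => /=; move: (#|Y :|: _|) (#|f @: _|) (#|Y|) #|V|; clear; lia.
  have p4' v : v \in E -> v \notin cover_seq s ->
      (psi v \notin Y) && (psi v \notin f @: cover_seq s).
    move=> vE vc; have vE' : v \notin E' by apply: contraNN vc; apply/subsetP.
    by have /andP[] := p4 v vE vE'; rewrite in_setU negb_or.
  pose g v := if v \in cover_seq s then f v else psi v.
  have gc : {in cover_seq s, g =1 f} by move=> v vc; rewrite /g vc.
  have gE : {in E, g =1 psi}.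
    move=> v vE; rewrite /g; case: ifP => // vc; rewrite p1 //.
    by rewrite setIC -EE' inE vE vc.
  exists g; split.
  - move=> v vE0; rewrite gc ?f1 //; apply/cover_seqP; by exists E0.
  - split.
      move=> u v; rewrite cov !in_setU.
      case: (boolP (u \in cover_seq s)) => [uc _|uc]; rewrite ?orbF ?orbT.
        case: (boolP (v \in cover_seq s)) => [vc _|vc]; rewrite ?orbF ?orbT.
          by rewrite !gc //; apply: f2.
        move=> vE; rewrite gc // gE // => e.
        by have /andP[_] := p4' _ vE vc; rewrite -e imset_f.
      move=> uE; case: (boolP (v \in cover_seq s)) => [vc _|vc]; rewrite ?orbF ?orbT.
        rewrite (gc v) // gE // => e.
        by have /andP[_] := p4' _ uE uc; rewrite e imset_f.
      by move=> vE; rewrite !gE //; apply: p2.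
    move=> D; rewrite inE => /orP[/eqP->|Ds]; first by rewrite (eq_in_imset gE).
    rewrite (@eq_in_imset _ _ g f) ?f3 // => v vD; apply: gc; apply/cover_seqP; by exists D.
  - rewrite -setI_eq0; apply/eqP/setP => x; rewrite !inE; apply/negP => /andP[/imsetP[v]].
    rewrite cov in_setU => vEc -> gY.
    have [vc|vc] := boolP (v \in cover_seq s).
      by move/pred0P/(_ (f v)): f4; rewrite /= -gc // gY gc // imset_f.
    rewrite (negPf vc) orbF in vEc; rewrite gE // in gY.
    by have /andP[] := p4' _ vEc vc; rewrite gY.
move=> E0s'; move: E0s; rewrite inE (negPf E0s') orbF => /eqP e0; subst E0.
have [|psi [p1 p2 p3 p4]] :=
  @swap_edge N k V X A E E' phi Y cA _ cE cE' inj phiA.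
  have : #|V| * 3 <= #|V| * (size s).+2 by rewrite leq_mul2l !ltnS size_s orbT.
  by move: leN kV => /=; move: #|Y| #|V|; clear; lia.
(* The part of the image of [E] outside the image of [E'] joins the forbidden set, so that the rest
   of the tree meets the placed edge only along [E']. *)
have [||f [f1 [f2 f3] f4]] :=
    IH E' psi (Y :|: (phi @: E :\: psi @: E')) ts unifs E's p2 p3.
- rewrite -setI_eq0; apply/eqP/setP => x; rewrite !inE; apply/negP => /andP[/imsetP[v vE' ->]].
  rewrite imset_f //= orbF => pY.
  have [vE|vE] := boolP (v \in E).
    rewrite p1 ?inE ?vE // in pY.
    by move/pred0P/(_ (phi v)): dY; rewrite /= pY imset_f.
  by have /andP[] := p4 v vE' vE; rewrite pY.
- have : #|Y :|: (phi @: E :\: psi @: E')| <= #|Y| + #|V|.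
    rewrite cardsU; apply: leq_trans (leq_subr _ _) _; rewrite leq_add2l.
    apply: leq_trans (subset_leq_card (subsetDl _ _)) _.
    by apply: leq_trans (leq_imset_card _ _) (max_card _).
  by move: leN => /=; rewrite !mulnS; move: #|Y| #|V| (#|Y :|: _|); clear; lia.
have f4' v : v \in cover_seq s -> (f v \notin Y) /\ (f v \in phi @: E -> f v \in psi @: E').
  move=> vc; have := disjointFr f4 (imset_f f vc); rewrite in_setU inE.
  by move/negbT; rewrite negb_or negb_and negbK => /andP[-> /orP[->|/negPf->]].
pose g v := if v \in cover_seq s then f v else phi v.
have gc : {in cover_seq s, g =1 f} by move=> v vc; rewrite /g vc.
have gE : {in E, g =1 phi}.
  move=> v vE; rewrite /g; case: ifP => // vc.
  have vEE' : v \in E :&: E' by rewrite -EE' inE vE.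
  by rewrite -p1 // f1 //; case/setIP: vEE'.
have sep u v : u \in E -> u \notin cover_seq s -> v \in cover_seq s -> phi u <> f v.
  move=> uE uc vc e; have [_] := f4' v vc; rewrite -e imset_f // => /(_ isT).
  case/imsetP => e' e'E' ee; have [e'E|e'E] := boolP (e' \in E).
    rewrite p1 ?inE ?e'E // in ee; move: (inj _ _ uE e'E ee) => ue.
    by case/negP: uc; apply: (subsetP E'cov); rewrite ue.
  by have /andP[_] := p4 e' e'E' e'E; rewrite -ee imset_f.
exists g; split=> //.
- split.
    move=> u v; rewrite cov !in_setU.
    case: (boolP (u \in cover_seq s)) => [uc _|uc]; rewrite ?orbF ?orbT.
      case: (boolP (v \in cover_seq s)) => [vc _|vc]; rewrite ?orbF ?orbT.
        by rewrite !gc //; apply: f2.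
      by move=> vE; rewrite gc // gE // => e; case: (sep v u).
    move=> uE; case: (boolP (v \in cover_seq s)) => [vc _|vc]; rewrite ?orbF ?orbT.
      by rewrite (gc v) // gE // => e; case: (sep u v).
    by move=> vE; rewrite !gE //; apply: inj.
  move=> D; rewrite inE => /orP[/eqP->|Ds]; first by rewrite (eq_in_imset gE).
  rewrite (@eq_in_imset _ _ g f) ?f3 // => v vD; apply: gc; apply/cover_seqP; by exists D.
- rewrite -setI_eq0; apply/eqP/setP => x; rewrite !inE; apply/negP => /andP[/imsetP[v]].
  rewrite cov in_setU => vEc -> gY.
  have [vc|vc] := boolP (v \in cover_seq s).
    by case: (f4' v vc); rewrite -gc // gY.
  rewrite (negPf vc) orbF in vEc; rewrite gE // in gY.
  by move/pred0P/(_ (phi v)): dY; rewrite /= gY imset_f.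
Qed.

Definition shadow (X : finType) (A : {set {set X}}) : {set {set X}} :=
  \bigcup_(E in A) [set E :\ a | a in E].

(** While some shadow set has at most [N] extensions, all members containing it are deleted. Each
    round costs at most [N] members and removes that set from the shadow for good. *)
Lemma cleaning N k (X : finType) (A : {set {set X}}) :
  (forall E, E \in A -> #|E| = k) ->
  exists2 A' : {set {set X}}, A' \subset A &
    clean N k A' /\ #|A| <= #|A'| + N * #|shadow A|.
Proof.
elim: {A}#|A| {-2}A (leqnn #|A|) => [|n IH] A.
  rewrite leqn0 cards_eq0 => /eqP-> unif; exists set0; rewrite ?sub0set //.
  by rewrite cards0; split=> //; split=> E; rewrite inE.
move=> leA unif.
have [/forall_inP cl|] :=
  boolP [forall E in A, [forall a in E, N < #|[set b | b |: E :\ a \in A]|]].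
  exists A => //; split; last by rewrite leq_addr.
  by split=> // E a EA aE; move/forall_inP: (cl E EA); apply.
case/forall_inPn => E EA /forall_inPn[a aE]; rewrite -leqNgt => leN.
pose Z := E :\ a; pose B := [set D in A | Z \subset D].
have EB : E \in B by rewrite inE EA subsetDl.
have cB : #|B| <= N.
  apply: leq_trans leN; rewrite -(card_imset B (@inj_id _)).
  apply: leq_trans (leq_imset_card (fun b => b |: Z) _).
  apply: subset_leq_card; apply/subsetP => _ /imsetP[D /setIdP[DA sZD] ->].
  have /cards1P[b Db] : #|D :\: Z| == 1.
    rewrite cardsDS // (unif D DA) -(unif E EA).
    by rewrite (cardsD1 a E) aE /= addnK.
  have De : D = b |: Z by rewrite -Db setUC -{1}(setIidPr sZD) setID.
  by apply/imsetP; exists b; rewrite // inE -De.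
have sAB : A :\: B \subset A by apply: subsetDl.
have [||A' sA' [clA' leA']] := IH (A :\: B).
- rewrite -ltnS; apply: leq_trans leA; apply: proper_card; apply/properP; split=> //.
  by exists E => //; rewrite inE EB.
- by move=> D /(subsetP sAB); apply: unif.
exists A'; first exact: subset_trans sAB.
split=> //.
have : #|shadow (A :\: B)| < #|shadow A|.
  apply: proper_card; apply/properP; split.
    apply/bigcupsP => D /(subsetP sAB) DA; exact: (bigcup_max D).
  exists Z; first by apply/bigcupP; exists E => //; apply: imset_f.
  apply/negP => /bigcupP[D /setDP[DA DB] /imsetP[d dD e]].
  by case/negP: DB; rewrite inE DA e subsetDl.
have : #|A| <= #|A :\: B| + N.
  have -> : #|A| = #|A :&: B| + #|A :\: B| by rewrite cardsID.
  rewrite addnC leq_add2l; apply: leq_trans cB; apply: subset_leq_card; exact: subsetIr.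
move: leA'; rewrite mulnC; set p := #|shadow _|; set q := #|shadow A|; move: (#|A'|) (#|A|) (#|A :\: B|); clear; nia.
Qed.

(** A member survives [cleaning], and the head edge placed on it is the root of a [tree_embedding].
    Hence a family without the tree is at most linear in its shadow. *)
Lemma tree_turan k (V X : finType) (A : {set {set X}}) (s : seq {set V}) :
  0 < k -> (forall E, E \in A -> #|E| = k) -> tree_seq s -> s != [::] ->
  (forall E, E \in s -> #|E| = k) ->
  #|V| * (size s).+1 * #|shadow A| < #|A| ->
  exists f : V -> X, embeds f s A.
Proof.
move=> k0 unifA ts s0 unif lt.
have [A' sA' [clA' le]] := @cleaning (#|V| * (size s).+1) k X A unifA.
have /card_gt0P[D DA'] : 0 < #|A'| by move: le lt; clear; lia.
case: s s0 ts unif lt clA' le => // E s _ ts unif lt clA' le.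
have /card_gt0P[x _] : 0 < #|D| by rewrite clA'.1.
have [||||f [f1 f2 f3]] := @ext_inj V X set0 E D (fun=> x).
- exact: sub0set.
- by rewrite unif ?mem_head // clA'.1.
- by move=> u v; rewrite inE.
- by rewrite imset0 sub0set.
have fE : f @: E = D by rewrite (card_imset_in f2 f3) // unif ?mem_head // clA'.1.
have [|||g [g1 [g2 g3] g4]] :=
  @tree_embedding _ _ _ _ _ _ E f set0 clA' ts unif (mem_head _ _) f2.
- by rewrite fE.
- by rewrite disjoint_sym disjoints_subset sub0set.
- by rewrite cards0.
by exists g; split=> // B Bs; apply: (subsetP sA'); apply: g3.
Qed.

(** * The edges at the last vertex of the cross-cut *)

(** A selection of edges stays in tree order when each selected edge, apart from the first, keeps a
    selected parent. *)
Lemma tree_seq_filter (V : finType) (s : seq {set V}) (P : pred {set V}) :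
  (forall i, i < size s -> P (nth set0 s i) ->
     (forall j, j < i -> ~~ P (nth set0 s j)) \/
     exists2 a, a < i & P (nth set0 s a) /\
       forall j, j < i -> P (nth set0 s j) ->
         nth set0 s i :&: nth set0 s j \subset nth set0 s a) ->
  tree_seq (rev (filter P s)).
Proof.
move=> tP; rewrite -[s in filter P s](take_size s).
have : size s <= size s by [].
elim: {1 3}(size s) => [|n IH] len; first by rewrite take0.
rewrite (take_nth set0 len) filter_rcons; case: ifP => Pn; last exact: IH (ltnW len).
rewrite rev_rcons /=; split; first exact: IH (ltnW len).
have mem_take j : j < n -> nth set0 s j \in take n s.
  by move=> jn; rewrite -(nth_take set0 jn) mem_nth // size_takel // ltnW.
case: (tP n len Pn) => [noP|[a an [Pa sub]]].
  left; apply/nilP; rewrite /nilp size_rev size_filter -leqn0 leqNgt -has_count.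
  apply/hasPn => E /(nthP set0)[j]; rewrite size_takel ?(ltnW len) // => jn <-.
  by rewrite nth_take // noP.
right; exists (nth set0 s a); first by rewrite mem_rev mem_filter Pa mem_take.
apply/subsetP => v /setIP[vn /cover_seqP[E]].
rewrite mem_rev mem_filter => /andP[PE /(nthP set0)[j]].
rewrite size_takel ?(ltnW len) // => jn; rewrite nth_take // => ej vE.
by apply: (subsetP (sub j jn _)); rewrite ej // inE vn.
Qed.

Lemma tree_ordering_parent (V : finType) (H : {set {set V}}) s i :
  tree_ordering H s -> 0 < i < size s ->
  exists2 a, a < i & forall j, j < i ->
    nth set0 s i :&: nth set0 s j \subset nth set0 s a.
Proof.
case=> _ _ par /andP[i0 ilt]; have [a ai sub] := par i i0 ilt.
exists a => // j ji; apply: subset_trans sub; apply: setIS.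
exact: (bigcup_max (Ordinal ji)).
Qed.

Lemma tree_ordering_seq (V : finType) (H : {set {set V}}) s :
  tree_ordering H s -> tree_seq (rev s).
Proof.
move=> tree; rewrite -(filter_predT s); apply: tree_seq_filter => i ilt _.
case: i ilt => [|i] ilt; first by left.
have [a ai sub] := tree_ordering_parent tree (ilt : 0 < i.+1 < size s).
by right; exists a => //; split=> // j ji _; apply: sub.
Qed.

Lemma sigma_le (V : finType) (H : {set {set V}}) (S : {set V}) :
  cross_cut H S -> sigma H <= #|S|.
Proof.
rewrite /sigma => cS; have : S \in index_enum {set V} by rewrite mem_index_enum.
elim: (index_enum _) => // A l IH; rewrite inE big_cons.
case/predU1P => [<-|Sl]; first by rewrite cS geq_minl.
by case: ifP => _; [apply: leq_trans (geq_minr _ _) _|]; apply: IH.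
Qed.

Lemma cross_cut_inj (V : finType) (H : {set {set V}}) (S E : {set V}) u v :
  cross_cut H S -> E \in H -> u \in S -> v \in S -> u \in E -> v \in E -> u = v.
Proof.
move/forall_inP => cS /cS/cards1P[x e] uS vS uE vE.
have : u \in S :&: E by rewrite inE uS.
have : v \in S :&: E by rewrite inE vS.
by rewrite e !inE => /eqP-> /eqP->.
Qed.

Lemma cross_cut_ex (V : finType) (H : {set {set V}}) (S E : {set V}) :
  cross_cut H S -> E \in H -> exists2 v, v \in S & v \in E.
Proof.
move/forall_inP => cS /cS/cards1P[x e]; exists x.
  by have := set11 x; rewrite -e => /setIP[].
by have := set11 x; rewrite -e => /setIP[].
Qed.

Lemma min_cross_cut_edge (V : finType) (H : {set {set V}}) (S : {set V}) v :
  min_cross_cut H S -> v \in S -> exists2 E, E \in H & v \in E.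
Proof.
case/andP => cS /eqP mS vS.
have [/exists_inP[E EH vE]|] := boolP [exists E in H, v \in E]; first by exists E.
rewrite negb_exists_in => /forall_inP noE.
have cS' : cross_cut H (S :\ v).
  apply/forall_inP => E EH; rewrite -(eqP (forall_inP cS E EH)); apply/eqP.
  apply: eq_card => x; rewrite !inE. case: (x =P v) => // ->.
  by rewrite /= (negPf (noE E EH)) andbF.
by have := sigma_le cS'; rewrite -mS (cardsD1 v S) vS add1n ltnn.
Qed.

(** Two edges of a linear star share the center alone, so any [w] common to them is the center,
    which [is_copy] does not name. *)
Lemma linear_star_inter (r p : nat) (V : finType) (G : {set {set V}}) D D' w v :
  is_copy (linear_star r p) G -> D \in G -> D' \in G -> D != D' ->
  w \in D -> w \in D' -> v \in D -> v \in D' -> v = w.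
Proof.
case=> f injf -> /imsetP[_ /imsetP[i _ ->] ->] /imsetP[_ /imsetP[j _ ->] ->] ne.
have nij : i != j by apply: contraNneq ne => ->.
have main u : u \in f @: (None |: [set Some (i, j0) | j0 : 'I_r.-1]) ->
    u \in f @: (None |: [set Some (j, j0) | j0 : 'I_r.-1]) -> u = f None.
  case/imsetP => a aD -> /imsetP[b bD /injf e]; subst b; congr f.
  case/setU1P: aD => // /imsetP[x _ ea]; subst a.
  by case/setU1P: bD => // /imsetP[y _ [e _]]; rewrite e eqxx in nij.
by move=> wD wD' vD vD'; rewrite (main v vD vD') (main w wD wD').
Qed.

Lemma shared_degree (V : finType) (H : {set {set V}}) (E D : {set V}) v :
  E \in H -> D \in H -> E != D -> v \in E -> v \in D -> degree H v != 1.
Proof.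
move=> EH DH ne vE vD; rewrite /degree; apply/negP => /cards1P[B e].
have : E \in edges_at H v by rewrite inE EH.
have : D \in edges_at H v by rewrite inE DH.
by rewrite e !inE => /eqP eD /eqP eE; rewrite eE eD eqxx in ne.
Qed.

(** These are the only vertices through which an edge can meet other edges. *)
Lemma core_size (r : nat) (V : finType) (H : {set {set V}}) (E : {set V}) :
  2 <= r -> uniform r H -> reducible (r - 2) H -> E \in H ->
  #|[set v in E | degree H v != 1]| <= 2.
Proof.
move=> r2 /forall_inP unif red EH; have := red E EH; have /eqP := unif E EH.
rewrite -(cardsID [set v | degree H v == 1] E) => e.
have -> : [set v in E | degree H v == 1] = E :&: [set v | degree H v == 1].
  by apply/setP => v; rewrite !inE.
have -> : [set v in E | degree H v != 1] = E :\: [set v | degree H v == 1].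
  by apply/setP => v; rewrite !inE andbC.
by move: r2 e; move: (#|_ :&: _|) (#|_ :\: _|); clear; lia.
Qed.

(* Let D0 be the first edge at w and Ea its parent. An edge after D0 that avoids
   w contains another vertex of S, which is already present before D0 because w
   comes last; so its parent avoids w too, and descending along parents takes any
   vertex it shares with an edge at w back into D0 :&: Ea. *)
Lemma star_attachment (r t p : nat) (V : finType) (H : {set {set V}})
    (s : seq {set V}) (S : {set V}) (w : V) :
  2 <= r -> uniform r H -> reducible (r - 2) H -> tree_ordering H s ->
  min_cross_cut H S -> included_last s S w -> #|S| = t.+2 ->
  is_copy (linear_star r p) (edges_at H w) ->
  exists q D0 Ea, [/\ tree_seq q, size q <= #|H| & q =i [set E in H | w \notin E]] /\
    [/\ D0 \in edges_at H w, Ea \in q,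
      (forall v E D, E \in q -> D \in edges_at H w -> v \in E -> v \in D ->
         v \in D0 :&: Ea), #|D0 :&: Ea| <= 2 &
      edges_at H w = [set D0] \/ #|D0 :&: Ea| <= 1].
Proof.
move=> r2 unif red tree mS [wS last] cS copy.
have [us sH _] := tree; have [cutS _] := andP mS.
have idx v : v \in S -> first_index s v < size s /\ v \in nth set0 s (first_index s v).
  move=> vS; have [E EH vE] := min_cross_cut_edge mS vS.
  have hs : has (fun E : {set V} => v \in E) s by apply/hasP; exists E; rewrite ?sH.
  by rewrite /first_index -has_find hs (nth_find set0 hs).
have nthH i : i < size s -> nth set0 s i \in H by move=> ilt; rewrite -sH mem_nth.
pose i0 := first_index s w; have [i0lt wi0] := idx w wS; rewrite -/i0 in i0lt wi0.
have before i : i < i0 -> w \notin nth set0 s i.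
  by move=> ii; have := before_find set0 ii => /= ->.
have idxlt v : v \in S -> v != w -> first_index s v < i0.
  move=> vS nvw; rewrite ltn_neqAle last // andbT; apply: contra_neq nvw => e.
  have [lt1 v1] := idx v vS; rewrite e in v1.
  exact: (cross_cut_inj cutS (nthH i0 i0lt)).
(* As [#|S| = t.+2], a second point of [S] exists, and it appears strictly before [w]. *)
have i0pos : 0 < i0.
  have [v vS] := @exists_notin _ S [set w] ltac:(by rewrite cS cards1).
  rewrite inE => nvw; exact: leq_ltn_trans (idxlt v vS nvw).
have Sv E : E \in H -> w \notin E -> exists v, [/\ v \in S, v \in E & v != w].
  move=> EH wE; have [v vS vE] := cross_cut_ex cutS EH; exists v; split=> //.
  by apply: contraNneq wE => <-.
have par i : 0 < i < size s -> w \notin nth set0 s i -> exists2 a, a < i &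
    w \notin nth set0 s a /\ forall j, j < i ->
    nth set0 s i :&: nth set0 s j \subset nth set0 s a.
  move=> /andP[ip ilt] wi; have [a ai sub] := tree_ordering_parent tree (introT andP (conj ip ilt)).
  exists a => //; split=> //; have [ii|ii] := ltnP i i0.
    by apply: before; apply: ltn_trans ii.
  have [v [vS vi nvw]] := Sv _ (nthH i ilt) wi.
  have [vlt vidx] := idx v vS; have va : v \in nth set0 s a.
    by apply: (subsetP (sub _ (leq_trans (idxlt v vS nvw) ii))); rewrite inE vi.
  apply: contra_neqN nvw => wa.
  by apply: (cross_cut_inj cutS (nthH a (ltn_trans ai ilt))).
have [a0 a0i sub0] := tree_ordering_parent tree (introT andP (conj i0pos i0lt)).
pose D0 := nth set0 s i0; pose Ea := nth set0 s a0.
have wEa : w \notin Ea by apply: before.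
pose P := [pred E : {set V} | w \notin E].
have EaH : Ea \in H by apply: nthH; apply: ltn_trans i0lt.
have D0H : D0 \in H by apply: nthH.
have D0w : D0 \in edges_at H w by rewrite inE D0H.
have attach j i v : j < size s -> i < size s -> w \notin nth set0 s j ->
    w \in nth set0 s i -> v \in nth set0 s j -> v \in nth set0 s i ->
    v \in D0 :&: Ea.
  elim/ltn_ind: j i => j IH i jlt ilt wj wi vj vi.
  have i0i : i0 <= i by rewrite leqNgt; apply: contraTN wi; apply: before.
  case: (ltngtP j i) => ji.
  - have [e|nei] := eqVneq i i0.
      rewrite e in ji vi; rewrite inE vi; apply: (subsetP (sub0 j ji)).
      by rewrite inE vi.
    have i0ilt : i0 < i by rewrite ltn_neqAle eq_sym nei.
    have [a ai sub] := tree_ordering_parent tree (introT andP (conj (leq_trans i0pos i0i) ilt)).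
    have wa : w \in nth set0 s a by apply: (subsetP (sub i0 i0ilt)); rewrite inE wi.
    have va : v \in nth set0 s a by apply: (subsetP (sub j ji)); rewrite inE vi.
    have alt : a < size s by apply: ltn_trans ilt.
    have e : v = w.
      apply: (linear_star_inter copy _ _ _ wi wa vi va).
      + by rewrite inE nthH.
      + by rewrite inE nthH.
      + by rewrite nth_uniq // gtn_eqF.
    by rewrite -e vj in wj.
  - have jp : 0 < j by apply: leq_ltn_trans ji.
    have [a aj [wa sub]] := par j (introT andP (conj jp jlt)) wj.
    have va : v \in nth set0 s a by apply: (subsetP (sub i ji)); rewrite inE vj.
    exact: (IH a aj i (ltn_trans aj jlt) ilt wa wi va vi).
  - by rewrite ji wi in wj.
have core v : v \in D0 :&: Ea -> v \in D0 /\ degree H v != 1.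
  case/setIP => vD vE; split=> //; apply: (shared_degree D0H EaH) => //.
  by rewrite nth_uniq ?gtn_eqF //; apply: ltn_trans i0lt.
exists (rev (filter P s)), D0, Ea; split; first split.
- apply: tree_seq_filter => -[|i] ilt /= wi; first by left.
  have [a ai [wa sub]] := par i.+1 ilt wi.
  by right; exists a => //; split=> // j ji _; apply: sub.
- rewrite size_rev size_filter; apply: leq_trans (count_size _ _) _.
  by rewrite -(card_uniqP us) (eq_card sH).
- by move=> E; rewrite mem_rev mem_filter sH [in RHS]inE andbC.
split=> //.
- by rewrite mem_rev mem_filter /= wEa sH.
- move=> v E D; rewrite mem_rev mem_filter /= sH => /andP[wE EH].
  rewrite inE => /andP[DH wD] vE vD; move: EH DH; rewrite -!sH.
  move=> /(nthP set0)[j jlt ej] /(nthP set0)[i ilt ei]; subst E D.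
  by apply: (attach j i).
- apply: leq_trans (core_size r2 unif red D0H); apply: subset_leq_card.
  by apply/subsetP => v /core[vD dv]; rewrite inE vD.
have [e|ne] := eqVneq (edges_at H w) [set D0]; first by left.
right; have /subsetPn[D Dw DD0] : ~~ (edges_at H w \subset [set D0]).
  by apply: contra_neqN ne => sub; apply/eqP; rewrite eqEsubset sub sub1set.
have [wD DH] : w \in D /\ D \in H by move: Dw; rewrite inE => /andP[].
(* With a second edge at [w], the vertex [w] takes one of the at most two core places of [D0]; as
   [w] is not in [Ea], only one place is left for [D0 :&: Ea]. *)
have wdeg : degree H w != 1.
  by apply: (shared_degree D0H DH) => //; rewrite eq_sym -in_set1.
rewrite -ltnS; apply: leq_trans (core_size r2 unif red D0H).
apply: proper_card; apply/properP; split.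
  by apply/subsetP => v /core[vD dv]; rewrite inE vD.
by exists w; rewrite inE ?wi0 // inE negb_and wEa orbT.
Qed.

(** * Assembling copies of the tree from traces off the cross-cut *)

Lemma coverP (V : finType) (P : {set {set V}}) v :
  reflect (exists2 E, E \in P & v \in E) (v \in cover P).
Proof. by apply: (iffP bigcupP) => -[E]; exists E. Qed.

(** Vertices in no edge only need room, which [#|V| <= #|X|] provides. *)
Lemma contains_embedding (V X : finType) (H : {set {set V}}) (F : {set {set X}})
    (f : V -> X) :
  #|V| <= #|X| -> {in cover H &, injective f} ->
  (forall E, E \in H -> f @: E \in F) -> contains H F.
Proof.
move=> le inj emb.
have [||g [g1 g2 _]] := @ext_inj V X (cover H) setT setT f (subsetT _) _ inj _.
- by rewrite !cardsT.
- exact: subsetT.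
apply/existsP; exists (finfun g); apply/andP; split.
  by apply/injectiveP => u v; rewrite !ffunE; apply: g2; rewrite inE.
apply/forall_inP => E EH; rewrite (_ : _ @: E = f @: E) ?emb //.
apply: eq_in_imset => v vE; rewrite ffunE g1 //; apply/coverP; by exists E.
Qed.

Lemma card_trace k (V : finType) (H : {set {set V}}) (S E : {set V}) :
  uniform k.+1 H -> cross_cut H S -> E \in H -> #|E :\: S| = k.
Proof.
move=> /forall_inP unif /forall_inP cut EH.
have := eqP (unif E EH); rewrite -(cardsID S E) setIC (eqP (cut E EH)) add1n.
by case.
Qed.

Lemma cover_seq_trace (V : finType) (q : seq {set V}) (S : {set V}) v :
  v \in cover_seq [seq E :\: S | E <- q] = (v \in cover_seq q) && (v \notin S).
Proof.
apply/cover_seqP/andP => [[_ /mapP[E Eq ->] /setDP[vE vS]]|[/cover_seqP[E Eq vE] vS]].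
  by split=> //; apply/cover_seqP; exists E.
by exists (E :\: S); [apply: map_f|rewrite inE vS].
Qed.

Lemma tree_seq_trace (V : finType) (q : seq {set V}) (S : {set V}) :
  tree_seq q -> tree_seq [seq E :\: S | E <- q].
Proof.
elim: q => //= E q IH [tq par]; split; first exact: IH.
case: par => [->|[E' E'q sub]]; [by left|right].
exists (E' :\: S); first exact: map_f.
apply/subsetP => v; rewrite inE cover_seq_trace !inE.
case/andP => /andP[vS vE] /andP[vc _]; rewrite vS; apply: (subsetP sub).
by rewrite inE vE.
Qed.

(** [S] goes into [U] and the traces [E :\: S] into [A]. Every edge has exactly one point of [S], so
    its image is a member of [A] with a point of [U] added. *)
Lemma trace_embedding k (V X : finType) (H : {set {set V}}) (F : {set {set X}})
    (S : {set V}) (U : {set X}) (A : {set {set X}}) (q : seq {set V})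
    (f : V -> X) :
  uniform k.+1 H -> cross_cut H S -> tree_seq q -> q =i H -> #|S| <= #|U| ->
  #|V| <= #|X| -> (forall B, B \in A -> [disjoint B & U]) ->
  (forall B c, B \in A -> c \in U -> c |: B \in F) ->
  embeds f [seq E :\: S | E <- q] A -> contains H F.
Proof.
move=> unif cut tq qH SU VX AU AF [injf embf].
have [||g [_ g2 g3]] := @ext_inj V X set0 S U f (sub0set _) SU.
- by move=> u v; rewrite inE.
- by rewrite imset0 sub0set.
pose h v := if v \in S then g v else f v.
have fU v : v \in cover_seq q -> v \notin S -> f v \notin U.
  move=> /cover_seqP[E Eq vE] vS.
  have := AU _ (embf (E :\: S) (map_f _ Eq)) => /disjointFr-> //.
  by rewrite imset_f // inE vS.
have gU v : v \in S -> g v \in U by move=> vS; apply: (subsetP g3); rewrite imset_f.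
have covq : cover H =i cover_seq q.
  by move=> v; apply/coverP/cover_seqP => -[E EH vE]; exists E; rewrite // ?qH // -qH.
apply: (@contains_embedding _ _ _ _ h) => //.
  move=> u v; rewrite !covq => uc vc; rewrite /h.
  case: ifPn => uS; case: ifPn => vS e.
  + exact: g2.
  + by have := fU v vc vS; rewrite -e gU.
  + by have := fU u uc uS; rewrite e gU.
  + by apply: injf => //; rewrite cover_seq_trace ?uc ?vc ?uS ?vS.
move=> E EH; have [x xS xE] := cross_cut_ex cut EH.
have -> : h @: E = g x |: f @: (E :\: S).
  apply/setP => y; apply/imsetP/setU1P => [[v vE ->]|[->|/imsetP[v /setDP[vE vS] ->]]].
  + rewrite /h; case: ifPn => vS; [left|right].
      by rewrite (cross_cut_inj cut EH vS xS vE xE).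
    by rewrite imset_f // inE vS.
  + by exists x; rewrite // /h xS.
  + by exists v; rewrite // /h (negPf vS).
apply: AF; last exact: gU.
by apply: embf; apply: map_f; rewrite qH.
Qed.

Section Attach.

Variables (k t : nat) (V X : finType) (H : {set {set V}}) (S : {set V}) (w : V).
Variables (q : seq {set V}) (D0 Ea : {set V}).
Hypotheses (unifH : uniform k.+1 H) (cutS : cross_cut H S) (wS : w \in S).
Hypotheses (cardS : #|S| = t.+1) (tq : tree_seq q) (size_q : size q <= #|H|).
Hypothesis qH : q =i [set E in H | w \notin E].
Hypotheses (D0w : D0 \in edges_at H w) (Eaq : Ea \in q).
Hypothesis attach : forall v E D, E \in q -> D \in edges_at H w ->
  v \in E -> v \in D -> v \in D0 :&: Ea.

(** The star at [w] is placed by [h]. For the other edges, the remaining $t$ points of [S] fill [U],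
    and the traces form a tree grown in [A] from [Ea :\: S]. These edges meet the star only in
    [D0 :&: Ea], whose image already lies in [B]. *)
Lemma attach_star (F : {set {set X}}) (U : {set X}) (A : {set {set X}})
    (h : V -> X) (B : {set X}) :
  #|V| <= #|X| -> #|U| = t -> clean (#|V| * #|H|.+3) k A ->
  (forall B, B \in A -> [disjoint B & U]) ->
  (forall B c, B \in A -> c \in U -> c |: B \in F) ->
  {in cover (edges_at H w) &, injective h} ->
  (forall E, E \in edges_at H w -> h @: E \in F) ->
  (forall v, v \in cover (edges_at H w) -> h v \notin U) ->
  B \in A -> h @: (D0 :&: Ea) \subset B ->
  contains H F.
Proof.
move=> VX cU clA AU AF injh embh hU BA sB.
have qHw E : E \in q -> E \in H /\ w \notin E by rewrite qH inE => /andP[].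
pose Cw := cover (edges_at H w).
have EaH : Ea \in H by case: (qHw _ Eaq).
have wD0 : w \in D0 by move: D0w; rewrite inE => /andP[].
have D0H : D0 \in H by move: D0w; rewrite inE => /andP[].
have D0Cw : D0 \subset Cw by apply/subsetP => v vD; apply/coverP; exists D0.
have cEa := card_trace unifH cutS EaH.
have kV : k <= #|V| by rewrite -cEa max_card.
have atS v : v \in D0 :&: Ea -> v \notin S.
  case/setIP => vD vE; apply/negP => vS.
  have e := cross_cut_inj cutS D0H vS wS vD wD0.
  by case: (qHw _ Eaq) => _; rewrite -e vE.
have hC : #|h @: Cw| <= #|V| by apply: leq_trans (leq_imset_card _ _) (max_card _).
(* [B] is first moved off the image of the star, except on the prescribed image of [D0 :&: Ea]. *)
have [|B' B'A [sB' dB']] := @refresh _ _ _ _ B (h @: (D0 :&: Ea)) (h @: Cw) clA _ BA sB.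
  rewrite !mulnS; move: hC kV; move: (#|h @: Cw|) #|V| (_ * #|H|); clear; lia.
have [||||phi [p1 p2 p3]] := @ext_inj V X (D0 :&: Ea) (Ea :\: S) B' h.
- apply/subsetP => v vA; rewrite inE atS //; by case/setIP: vA.
- by rewrite cEa clA.1.
- move=> u v /setIP[uD _] /setIP[vD _]; apply: injh; exact: (subsetP D0Cw).
- done.
have phiB' : phi @: (Ea :\: S) = B' by rewrite (card_imset_in p2 p3) // cEa clA.1.
have hAC : h @: (D0 :&: Ea) \subset h @: Cw.
  by apply: imsetS; apply: subset_trans D0Cw; apply: subsetIl.
have [|||||f [f1 [f2 f3] f4]] := @tree_embedding _ _ V X A [seq E :\: S | E <- q]
    (Ea :\: S) phi (h @: Cw :\: h @: (D0 :&: Ea)) clA (tree_seq_trace S tq) _ _ p2.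
- by move=> _ /mapP[E /qHw[EH _] ->]; apply: card_trace cutS EH.
- exact: map_f.
- by rewrite phiB'.
- rewrite phiB' -setI_eq0; apply/eqP/setP => x; rewrite !inE; apply/negP.
  case/andP => xB' /andP[xA xC]; have := disjointFr dB' (x := x).
  by rewrite inE xA xB' xC => /(_ isT).
- rewrite size_map.
  have : #|h @: Cw :\: h @: (D0 :&: Ea)| <= #|h @: Cw|.
    by apply: subset_leq_card; apply: subsetDl.
  have : #|V| * (size q).+1 <= #|V| * #|H|.+1 by rewrite leq_mul2l ltnS size_q orbT.
  move: hC; rewrite !mulnS.
  move: (#|_ :\: _|) (#|h @: Cw|) #|V| (_ * #|H|) (_ * size q); clear; lia.
have SU : #|S :\ w| <= #|U| by move: cardS; rewrite (cardsD1 w S) wS cU add1n => -[->].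
have [||g [_ g2 g3]] := @ext_inj V X set0 (S :\ w) U h (sub0set _) SU.
- by move=> u v; rewrite inE.
- by rewrite imset0 sub0set.
pose C := cover_seq q.
have fU v : v \in C -> v \notin S -> f v \notin U.
  move=> /cover_seqP[E Eq vE] vS.
  have := AU _ (f3 (E :\: S) (map_f _ Eq)) => /disjointFr-> //.
  by rewrite imset_f // inE vS.
have gU v : v \in S -> v != w -> g v \in U.
  by move=> vS vw; apply: (subsetP g3); rewrite imset_f // !inE vw.
have CwS v : v \in Cw -> v \in S -> v = w.
  case/coverP => D; rewrite inE => /andP[DH wD] vD vS.
  exact: (cross_cut_inj cutS DH).
have wCw : w \in Cw by apply: (subsetP D0Cw).
have CCw v : v \in C -> v \in Cw -> v \in D0 :&: Ea.
  by case/cover_seqP => E Eq vE /coverP[D Dw vD]; apply: attach Eq Dw vE vD.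
have fh v : v \in D0 :&: Ea -> f v = h v.
  move=> vA; rewrite f1 ?p1 // inE atS //; by case/setIP: vA.
pose e v := if v \in Cw then h v else if v \in S then g v else f v.
have covH v : v \in cover H -> v \notin Cw -> v \in C.
  case/coverP => E EH vE vC; apply/cover_seqP; exists E => //.
  by rewrite qH inE EH; apply: contraNN vC => wE; apply/coverP; exists E; rewrite // inE EH.
have tr v : v \in C -> v \notin S -> v \in cover_seq [seq E :\: S | E <- q].
  by rewrite cover_seq_trace => -> ->.
have fCw u v : u \in Cw -> v \notin Cw -> v \in C -> v \notin S -> h u <> f v.
  move=> uC vCw vC vS ee.
  have fv : f v \in f @: cover_seq [seq E :\: S | E <- q] by rewrite imset_f // tr.
  have := disjointFr f4 fv; rewrite in_setD -ee (imset_f h uC) andbT => /negbFE/imsetP[x xA].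
  have xCw : x \in Cw by apply: (subsetP D0Cw); case/setIP: xA.
  have xC : x \in C.
    by apply/cover_seqP; exists Ea => //; case/setIP: xA.
  rewrite ee -fh // => exv; case/negP: vCw.
  by rewrite (f2 v x _ _ exv) // tr // atS.
have nw v : v \notin Cw -> v != w by apply: contraNneq => ->.
apply: (@contains_embedding _ _ _ _ e) => //.
  move=> u v uH vH; rewrite /e.
  case: (ifPn (u \in Cw)) => uC; case: (ifPn (v \in Cw)) => vC.
  - exact: injh.
  - case: ifPn => vS ee; first by have := hU u uC; rewrite ee gU // nw.
    by case: (fCw u v uC vC (covH v vH vC) vS).
  - case: ifPn => uS ee; first by have := hU v vC; rewrite -ee gU // nw.
    by case: (fCw v u vC uC (covH u uH uC) uS).
  - have uCC := covH u uH uC; have vCC := covH v vH vC.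
    case: ifPn => uS; case: ifPn => vS ee.
    + by apply: g2 => //; rewrite !inE ?uS ?vS nw.
    + by have := fU v vCC vS; rewrite -ee gU // nw.
    + by have := fU u uCC uS; rewrite ee gU // nw.
    + by apply: f2 => //; apply: tr.
move=> E EH; have [wE|wE] := boolP (w \in E).
  have Ew : E \in edges_at H w by rewrite inE EH.
  rewrite (_ : e @: E = h @: E) ?embh //; apply: eq_in_imset => v vE.
  by rewrite /e (_ : v \in Cw) //; apply/coverP; exists E.
have Eq : E \in q by rewrite qH inE EH.
have [x xS xE] := cross_cut_ex cutS EH.
have xw : x != w by apply: contraNneq wE => <-.
have eE v : v \in E -> v \notin S -> e v = f v.
  move=> vE vS; rewrite /e (negPf vS); case: ifPn => // vC.
  by rewrite fh // CCw //; apply/cover_seqP; exists E.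
have ex : e x = g x.
  rewrite /e xS; case: ifPn => // xC; by rewrite (CwS x xC xS) eqxx in xw.
have -> : e @: E = g x |: f @: (E :\: S).
  apply/setP => y; apply/imsetP/setU1P => [[v vE ->]|[->|/imsetP[v /setDP[vE vS] ->]]].
  + have [vS|vS] := boolP (v \in S).
      by left; rewrite (cross_cut_inj cutS EH vS xS vE xE).
    by right; rewrite eE // imset_f // inE vS.
  + by exists x.
  + by exists v; rewrite // eE.
apply: AF; last exact: gU.
by apply: f3; apply: map_f.
Qed.

End Attach.

(** * Pairs that are kernels *)

(** A robust form of the center of a large sunflower. With [b = #|V|], the image of any partial
    embedding of the tree can be dodged. *)
Definition kernel (b : nat) (X : finType) (F : {set {set X}}) (P : {set X}) :=
  [forall Y : {set X}, (#|Y| <= b) ==>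
     [exists D in F, (P \subset D) && [disjoint D :\: P & Y]]].

Definition pair_kernels (b : nat) (X : finType) (F : {set {set X}}) :=
  [set P : {set X} | (#|P| == 2) && kernel b F P].

Lemma subset_between (X : finType) (A B : {set X}) n :
  A \subset B -> #|A| <= n <= #|B| ->
  exists P : {set X}, [/\ A \subset P, P \subset B & #|P| = n].
Proof.
elim: n => [|n IH] sAB /andP[An nB].
  by exists A; split=> //; apply/eqP; rewrite -leqn0.
have [e|ne] := eqVneq #|A| n.+1; first by exists A.
have [|P [AP PB cP]] := IH sAB; first by rewrite (ltnW nB) -ltnS ltn_neqAle ne An.
have [x xB xP] := @exists_notin _ B P ltac:(by rewrite cP).
exists (x |: P); split; first by apply: subset_trans AP (subsetUr _ _).
  by rewrite subUset sub1set xB.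
by rewrite cardsU1 xP cP.
Qed.

Section PairKernels.

Variables (r : nat) (V X : finType) (H : {set {set V}}) (F : {set {set X}}).
Hypotheses (r2 : 2 <= r) (unifH : uniform r H) (red : reducible (r - 2) H).
Hypotheses (unifF : uniform r F) (VX : #|V| <= #|X|).

Let core (E : {set V}) := [set v in E | degree H v != 1].

(** The core padded to exactly two vertices: the spines are edges of a graph that carries every
    intersection of two edges of [H]. The default [set0] is never reached for an edge of [H]. *)
Let spine (E : {set V}) : {set V} :=
  odflt set0 [pick P : {set V} | [&& #|P| == 2, core E \subset P & P \subset E]].

Let spineP E : E \in H -> [/\ #|spine E| = 2, core E \subset spine E & spine E \subset E].
Proof.
move=> EH; rewrite /spine; case: pickP => [P /and3P[/eqP]|no] //=.
have [||P [P1 P2 P3]] := @subset_between _ (core E) E 2.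
- by apply/subsetP => v; rewrite inE => /andP[].
- by rewrite (core_size r2 unifH red EH) (eqP (forall_inP unifH E EH)).
by move: (no P); rewrite P1 P2 P3.
Qed.

Let shared E D v : E \in H -> D \in H -> E != D -> v \in E -> v \in D -> v \in spine E.
Proof.
move=> EH DH ne vE vD; have [_ sub _] := spineP EH; apply: (subsetP sub).
by rewrite inE vE (shared_degree EH DH).
Qed.

Let tree_spine q : uniq q -> {subset q <= H} -> tree_seq q -> tree_seq (map spine q).
Proof.
elim: q => //= E q IH /andP[Eq uq] sub [tq par].
have subq : {subset q <= H} by move=> D Dq; apply: sub; rewrite inE Dq orbT.
have EH : E \in H by apply: sub; rewrite mem_head.
split; first exact: IH.
case: par => [->|[E' E'q sE']]; [by left|right]; exists (spine E'); first exact: map_f.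
apply/subsetP => v /setIP[vE /cover_seqP[_ /mapP[D Dq ->] vD]].
have vE1 : v \in E by case: (spineP EH) => _ _ /subsetP; apply.
have vD1 : v \in D by case: (spineP (subq D Dq)) => _ _ /subsetP; apply.
have vE' : v \in E'.
  by apply: (subsetP sE'); rewrite inE vE1; apply/cover_seqP; exists D.
apply: (@shared E' E v (subq _ E'q) EH _ vE' vE1).
by apply: contraNneq Eq => <-.
Qed.

(** Each spine sits on a kernel pair, which extends to an edge of [F] away from everything placed so
    far, at most [#|V|] vertices. The list [l] holds the edges already expanded. *)
Let petals (q l : seq {set V}) (f : V -> X) :
  embeds f (map spine q) (pair_kernels #|V| F) -> {subset q <= H} ->
  uniq l -> {subset l <= q} ->
  exists g : V -> X, [/\ {in cover_seq (map spine q), g =1 f},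
    {in cover_seq (map spine q) :|: cover_seq l &, injective g} &
    forall E, E \in l -> g @: E \in F].
Proof.
case=> injf embf subq; elim: l => [_ _|E l IH /= /andP[El ul] sub].
  by exists f; split=> //; rewrite /cover_seq big_nil setU0.
set C := cover_seq (map spine q) in injf IH *.
have [//||g [g1 g2 g3]] := IH; first by move=> D Dl; apply: sub; rewrite inE Dl orbT.
have Eq : E \in q by apply: sub; rewrite mem_head.
have EH := subq _ Eq.
have [sE1 sE2 sE3] := spineP EH.
have sEC : spine E \subset C.
  by apply/subsetP => v vE; apply/cover_seqP; exists (spine E); rewrite ?map_f.
pose CL := C :|: cover_seq l.
have gE : g @: spine E = f @: spine E.
  by apply: eq_in_imset => v vE; apply: g1; apply: (subsetP sEC).
have ECL v : v \in E -> v \in CL -> v \in spine E.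
  move=> vE /setUP[/cover_seqP[_ /mapP[D Dq ->] vD]|/cover_seqP[D Dl vD]].
    have [<-//|ne] := eqVneq D E.
    have vD1 : v \in D by case: (spineP (subq D Dq)) => _ _ /subsetP; apply.
    by apply: (shared EH (subq D Dq)); rewrite // eq_sym.
  apply: (shared EH (subq D _) _ vE vD); first by apply: sub; rewrite inE Dl orbT.
  by apply: contraNneq El => ->.
have := embf _ (map_f spine Eq); rewrite inE => /andP[_ /forallP/(_ (g @: CL))].
rewrite (leq_trans (leq_imset_card _ _) (max_card _)) /=.
case/exists_inP => D DF /andP[sD dD].
have cD : #|E| = #|D|.
  by rewrite (eqP (forall_inP unifH E EH)) (eqP (forall_inP unifF D DF)).
have [|||psi [p1 p2 p3]] := @ext_inj V X (spine E) E D g sE3.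
- by rewrite cD.
- by move=> u v uE vE; apply: g2; apply/setUP; left; apply: (subsetP sEC).
- by rewrite gE.
have psiD : psi @: E = D by rewrite (card_imset_in p2 p3).
pose h v := if v \in CL then g v else psi v.
have hE : {in E, h =1 psi}.
  by move=> v vE; rewrite /h; case: ifPn => // vC; rewrite p1 // ECL.
have hC : {in CL, h =1 g} by move=> v vC; rewrite /h vC.
have sep u v : u \in CL -> v \in E -> v \notin CL -> g u <> psi v.
  move=> uC vE vC e; have gu : g u \in g @: CL by rewrite imset_f.
  have := disjointFl dD gu; rewrite inE e -psiD imset_f // andbT => /negbFE.
  rewrite -gE => /imsetP[x xE ex]; rewrite -p1 // in ex.
  case/negP: vC; rewrite (p2 v x vE (subsetP sE3 _ xE) ex).
  by apply/setUP; left; apply: (subsetP sEC).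
have CE : C :|: cover_seq (E :: l) = CL :|: E.
  by rewrite /cover_seq big_cons setUCA setUC.
exists h; split.
- by move=> v vC; rewrite hC ?g1 // inE vC.
- move=> u v; rewrite CE !(in_setU _ CL E).
  case: (boolP (u \in CL)) => uC; case: (boolP (v \in CL)) => vC //=.
  + by move=> _ _; rewrite !hC //; apply: g2.
  + by move=> _ vE; rewrite hC // hE // => e; case: (sep u v).
  + by move=> uE _; rewrite (hC v) // hE // => e; case: (sep v u).
  + by move=> uE vE; rewrite !hE //; apply: p2.
move=> B; rewrite inE => /predU1P[->|Bl].
  by rewrite (eq_in_imset hE) psiD.
rewrite (@eq_in_imset _ _ h g) ?g3 // => v vB; apply: hC; apply/setUP; right.
by apply/cover_seqP; exists B.
Qed.

(** The shadow of a graph consists of single vertices. With more kernel pairs than stated,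
    [tree_turan] embeds the tree of spines and [petals] expands it to a copy of [H]. *)
Lemma pair_kernels_le (s : seq {set V}) :
  tree_ordering H s -> H != set0 -> ~~ contains H F ->
  #|pair_kernels #|V| F| <= #|V| * #|H|.+1 * #|X|.
Proof.
move=> tree H0; apply: contraNT; rewrite -ltnNge => lt.
have [us sH _] := tree.
have sub : {subset rev s <= H} by move=> E; rewrite mem_rev sH.
have ur : uniq (rev s) by rewrite rev_uniq.
have ts := tree_spine ur sub (tree_ordering_seq tree).
have unifG P : P \in pair_kernels #|V| F -> #|P| = 2 by rewrite inE => /andP[/eqP].
have sz : size s = #|H| by rewrite -(card_uniqP us) (eq_card sH).
have [|||f embf] := @tree_turan 2 V X _ _ isT unifG ts.
- rewrite -size_eq0 size_map size_rev sz; by rewrite cards_eq0.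
- by move=> _ /mapP[E /sub EH ->]; case: (spineP EH).
- rewrite size_map size_rev sz; apply: leq_ltn_trans lt; rewrite leq_mul2l; apply/orP; right.
  rewrite -[X in _ <= X]cardsT -(card_imset _ (@set1_inj X)).
  apply: subset_leq_card; apply/bigcupsP => P PG; apply/subsetP => _ /imsetP[a aP ->].
  have /cards1P[b ->] : #|P :\ a| == 1.
    by have := unifG P PG; rewrite (cardsD1 a) aP add1n => -[->].
  by apply: imset_f; rewrite inE.
have [|g [_ g2 g3]] := petals embf sub ur; first by [].
apply: (@contains_embedding _ _ _ _ g) => //.
  move=> u v /coverP[E EH uE] /coverP[D DH vD]; apply: g2; apply/setUP; right; apply/cover_seqP.
    by exists E; rewrite // mem_rev sH.
  by exists D; rewrite // mem_rev sH.
by move=> E EH; apply: g3; rewrite mem_rev sH.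
Qed.

End PairKernels.

(** * Kernels of tuples *)

Lemma card_bigcup_le (I X : finType) (P : {set I}) (F : I -> {set X}) :
  #|\bigcup_(i in P) F i| <= \sum_(i in P) #|F i|.
Proof.
elim/big_rec2: _ => [|i y A _ le]; first by rewrite cards0.
by rewrite cardsU; apply: leq_trans (leq_subr _ _) _; rewrite leq_add2l.
Qed.

Section TupleKernels.

Variables (b : nat) (I X : finType).
Implicit Types (F G : {set {ffun I -> X}}) (z : {ffun I -> X}) (A : {set I}).

(* Working with ordered tuples instead of edges replaces the r-partite
   subhypergraph of Fueredi's theorem. *)
Definition tuple_kernel F z A : bool :=
  [forall Y : {set X}, (#|Y| <= b) ==>
    [exists y in F, [forall i, if i \in A then y i == z i else y i \notin Y]]].

Definition kernel_type F z : {set {set I}} := [set A | tuple_kernel F z A].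

Lemma tuple_kernelP F z A :
  reflect (forall Y : {set X}, #|Y| <= b -> exists2 y, y \in F &
             {in A, y =1 z} /\ (forall i, i \notin A -> y i \notin Y))
          (tuple_kernel F z A).
Proof.
apply: (iffP forallP) => ker Y.
  move=> Yb; have /exists_inP[y yF /forallP ay] := implyP (ker Y) Yb.
  by exists y => //; split=> i iA; move: (ay i); rewrite ?iA ?(negPf iA) // => /eqP.
apply/implyP => /ker[y yF [y1 y2]]; apply/exists_inP; exists y => //.
by apply/forallP => i; case: ifPn => iA; [apply/eqP/y1 | apply: y2].
Qed.

Lemma tuple_kernelS F G z A : F \subset G -> tuple_kernel F z A -> tuple_kernel G z A.
Proof.
move=> sFG /tuple_kernelP ker; apply/tuple_kernelP => Y /ker[y yF ay].
by exists y => //; apply: (subsetP sFG).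
Qed.

Lemma tuple_kernelT F z : z \in F -> tuple_kernel F z setT.
Proof. by move=> zF; apply/tuple_kernelP => Y _; exists z => //; split=> // i; rewrite inE. Qed.

(** [Y] is dodged twice: first in [G1] with [A] fixed, then in [G0] with [A'] fixed. Positions of
    [A'] outside [A] leave [Y] in the first move, positions outside [A'] in the second. *)
Lemma tuple_kernelI G0 G1 z A A' :
  tuple_kernel G1 z A -> (forall y, y \in G1 -> tuple_kernel G0 y A') ->
  tuple_kernel G0 z (A :&: A').
Proof.
move=> /tuple_kernelP ker ker'; apply/tuple_kernelP => Y Yb.
have [y yG [y1 y2]] := ker Y Yb.
have /tuple_kernelP/(_ Y Yb)[u uG [u1 u2]] := ker' y yG.
exists u => //; split=> [i /setIP[iA iA']|i]; first by rewrite u1 ?y1.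
rewrite inE; case: (boolP (i \in A')) => iA'; last by move=> _; apply: u2.
by rewrite andbT => iA; rewrite u1 // y2.
Qed.

Lemma popular_type F1 : exists J : {set {set I}},
  #|F1| <= #|[set z in F1 | kernel_type F1 z == J]| * #|{: {set {set I}}}|.
Proof.
case: (@arg_maxnP {set {set I}} set0 xpredT
         (fun J => #|[set z in F1 | kernel_type F1 z == J]|) isT) => J _ mJ.
exists J; rewrite mulnC -cardsT; apply: (fiber_bound (f := kernel_type F1)) => [z _|B _].
  by rewrite inE.
exact: mJ.
Qed.

(* Passing repeatedly to the most popular type, the types decrease, so the type
   must repeat before they are exhausted. *)
Lemma stable_types m F0 F1 (J : {set {set I}}) :
  F1 \subset F0 -> (forall z, z \in F1 -> kernel_type F0 z = J) -> #|J| < m ->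
  exists G0 G1 G2 (J' : {set {set I}}),
    [/\ G2 \subset G1, G1 \subset G0, G0 \subset F0,
        (forall z, z \in G1 -> kernel_type G0 z = J') /\
        (forall z, z \in G2 -> kernel_type G1 z = J') &
        #|F1| <= #|G2| * #|{: {set {set I}}}| ^ m].
Proof.
elim: m F0 F1 J => // m IH F0 F1 J s10 tJ leJ; have [J' leF] := popular_type F1.
set F2 := [set z in F1 | _] in leF.
have s21 : F2 \subset F1 by apply/subsetP => z; rewrite inE => /andP[].
have tJ' z : z \in F2 -> kernel_type F1 z = J' by rewrite inE => /andP[_ /eqP].
have C0 : 0 < #|{: {set {set I}}}|.
  by rewrite -cardsT; apply/card_gt0P; exists set0; rewrite inE.
have [F20|/set0Pn[z zF2]] := eqVneq F2 set0.
  exists set0, set0, set0, set0; rewrite !sub0set; split=> //.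
    by split=> z; rewrite inE.
  by move: leF; rewrite F20 cards0 !mul0n leqn0 => /eqP->.
have sJ : J' \subset J.
  rewrite -(tJ' z zF2) -(tJ z (subsetP s21 z zF2)).
  by apply/subsetP => A; rewrite !inE; apply: tuple_kernelS.
have [e|ne] := eqVneq J' J.
  exists F0, F1, F2, J; split=> //; first by split=> // y yF2; rewrite tJ'.
  by apply: leq_trans leF _; rewrite leq_mul2l expnS leq_pmulr ?expn_gt0 ?C0 ?orbT.
have ltJ : #|J'| < m.
  rewrite -ltnS; apply: leq_trans leJ; rewrite ltnS.
  by apply: proper_card; rewrite properEneq ne sJ.
have [G0 [G1 [G2 [J2 [a1 a2 a3 a4 a5]]]]] := IH F1 F2 J' s21 tJ' ltJ.
exists G0, G1, G2, J2; split=> //; first exact: subset_trans a3 s10.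
by rewrite expnSr mulnA; apply: leq_trans leF _; rewrite leq_mul2r a5 orbT.
Qed.

Lemma card_agree (A : {set I}) z0 :
  #|[set z : {ffun I -> X} | [forall i in A, z i == z0 i]]| <= #|X| ^ #|~: A|.
Proof.
have [i0 _|noI] := pickP I; last first.
  rewrite (_ : #|~: A| = 0); last by apply: eq_card0 => i; move: (noI i).
  apply/card_le1_eqP => y z _ _; apply/ffunP => i; by move: (noI i).
pose x0 := z0 i0.
pose res (z : {ffun I -> X}) := [ffun i => if i \in A then x0 else z i].
rewrite -(card_in_imset (f := res)); last first.
  move=> y z; rewrite !inE => /forall_inP ay /forall_inP az /ffunP e.
  apply/ffunP => i; move: (e i); rewrite !ffunE; case: ifPn => // iA _.
  by rewrite (eqP (ay i iA)) (eqP (az i iA)).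
rewrite -(card_pffun_on x0); apply: subset_leq_card.
apply/subsetP => _ /imsetP[z _ ->]; apply/pffun_onP; split=> //.
by apply/subsetP => i; rewrite !inE ffunE; case: ifP => //; rewrite eqxx.
Qed.

(* A tuple whose restriction to A extends to no proper kernel is determined,
   up to boundedly many choices, by that restriction: the link of a non-kernel
   is covered by b points. *)
Lemma card_no_kernel_fiber F A z0 :
  #|[set z in F | [forall i in A, z i == z0 i] &&
     [forall B : {set I}, (A \subset B) && (B != setT) ==> ~~ tuple_kernel F z B]]|
  <= (#|I| * b) ^ #|~: A|.
Proof.
elim: {A}#|~: A| {-2}A (erefl #|~: A|) z0 => [|j IH] A cA z0; set Z := [set z in F | _].
  have A0 : ~: A = set0 by apply/eqP; rewrite -cards_eq0 cA.
  have AT : A = setT by rewrite -[A]setCK A0 setC0.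
  rewrite cA; apply/card_le1_eqP => y z.
  rewrite !inE AT => /and3P[_ /forall_inP ay _] /and3P[_ /forall_inP az _].
  by apply/ffunP => i; rewrite (eqP (ay i _)) ?(eqP (az i _)) ?inE.
have [->|/set0Pn[z1]] := eqVneq Z set0; first by rewrite cards0.
rewrite inE => /and3P[_ /forall_inP az1 /forallP/(_ A)].
rewrite subxx /=; case: eqP => [AT|_ /=].
  by move: cA; rewrite AT setCT cards0.
(* [Y] witnesses that [A] is no kernel: each tuple of [Z] takes a value in [Y] at some position
   outside [A], and fixing that value enlarges [A]. *)
case/forallPn => Y; rewrite negb_imply => /andP[Yb /exists_inPn noY].
pose ext (i : I) (y : X) := [ffun j => if j == i then y else z0 j].
pose fib (p : I * X) := [set z in F | [forall i in p.1 |: A, z i == ext p.1 p.2 i] &&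
  [forall B : {set I}, (p.1 |: A \subset B) && (B != setT) ==> ~~ tuple_kernel F z B]].
have sub : Z \subset \bigcup_(p in setX (~: A) Y) fib p.
  apply/subsetP => z; rewrite inE => /and3P[zF /forall_inP az /forallP kz].
  have := noY z zF; rewrite negb_forall => /existsP[i]; case: ifPn => iA.
    by rewrite (eqP (az i iA)) (eqP (az1 i iA)) eqxx.
  rewrite negbK => ziY; apply/bigcupP; exists (i, z i); first by rewrite !inE iA.
  rewrite inE zF /=; apply/andP; split.
    apply/forall_inP => l /setU1P[->|lA]; rewrite ffunE ?eqxx //.
    by case: (eqVneq l i) => [->//|_]; apply: az.
  apply/forallP => B; apply/implyP => /andP[sB BT]; apply: (implyP (kz B)).
  by rewrite BT (subset_trans (subsetUr _ _) sB).
apply: leq_trans (subset_leq_card sub) _.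
apply: (@leq_trans (\sum_(p in setX (~: A) Y) (#|I| * b) ^ j)).
  apply: leq_trans (card_bigcup_le _ _) _; apply: leq_sum => -[i y].
  rewrite !inE => /andP[iA yY].
  have cA' : #|~: (i |: A)| = j.
    move: cA; rewrite (cardsD1 i) inE iA add1n => -[<-]; apply: eq_card => l.
    by rewrite !inE negb_or.
  by have := IH _ cA' (ext i y); rewrite cA'.
rewrite sum_nat_const cardsX [in leqRHS]cA expnS leq_mul2r; apply/orP; right.
by rewrite leq_mul // max_card.
Qed.

End TupleKernels.

Lemma card_no_kernel b (I X : finType) (F : {set {ffun I -> X}}) (A : {set I}) :
  #|[set z in F | [forall B : {set I}, (A \subset B) && (B != setT) ==>
       ~~ tuple_kernel b F z B]]| <= #|X| ^ #|A| * (#|I| * b) ^ #|~: A|.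
Proof.
set Z := [set z in F | _].
have [->|/set0Pn[z0 _]] := eqVneq Z set0; first by rewrite cards0.
pose f (z : {ffun I -> X}) := [ffun i => if i \in A then z i else z0 i].
pose B := [set z : {ffun I -> X} | [forall i in ~: A, z i == z0 i]].
have cB : #|B| <= #|X| ^ #|A| by rewrite -[in X in _ <= X](setCK A); apply: card_agree.
apply: (@leq_trans (#|B| * (#|I| * b) ^ #|~: A|)); last by rewrite leq_mul2r cB orbT.
apply: (fiber_bound (f := f)) => [z _|y _].
  by rewrite inE; apply/forall_inP => i; rewrite inE ffunE => /negPf->.
apply: leq_trans (card_no_kernel_fiber b F A y); apply: subset_leq_card.
apply/subsetP => z; rewrite !inE => /andP[/andP[zF kz] /eqP e]; rewrite zF kz andbT /=.
by apply/forall_inP => i iA; rewrite -e ffunE iA.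
Qed.

(** For [i] outside [K] the complement of [i] is in [J]; for two points of [K] the complement of
    both is. So a pair is an intersection of members of [J] unless exactly one point of [K] lies
    outside it, and four positions always provide two such pairs. *)
Lemma two_pairs_closed (I : finType) (J : {set {set I}}) :
  4 <= #|I| -> setT \in J ->
  (forall A B, A \in J -> B \in J -> A :&: B \in J) ->
  (forall i j, i != j ->
     exists2 A, A \in J & (A != setT) && (~: [set i; j] \subset A)) ->
  exists P Q, [/\ P \in J, Q \in J, P != Q, #|P| = 2 & #|Q| = 2].
Proof.
move=> I4 JT capJ cov.
pose K := [set i | ~: [set i] \notin J].
have setC2P (A : {set I}) i j : ~: [set i; j] \subset A -> i \in A -> j \in A -> A = setT.
  move=> sub iA jA; apply/setP => l; rewrite inE.
  have [->//|li] := eqVneq l i; have [->//|lj] := eqVneq l j.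
  by apply: (subsetP sub); rewrite !inE negb_or li.
have KK i j : i != j -> i \in K -> j \in K -> ~: [set i; j] \in J.
  move=> ij; rewrite !inE => iK jK; have [A AJ /andP[AT sub]] := cov i j ij.
  have sub' x : x != i -> x != j -> x \in A.
    by move=> xi xj; apply: (subsetP sub); rewrite !inE negb_or xi.
  have [iA|iA] := boolP (i \in A); have [jA|jA] := boolP (j \in A).
  - by case/eqP: AT; apply: (setC2P A i j).
  - case/negP: jK; rewrite (_ : ~: _ = A) //; apply/setP => x; rewrite !inE.
    have [->|xj] := eqVneq x j; first by rewrite (negPf jA).
    by have [->|xi] := eqVneq x i; rewrite ?iA // sub'.
  - case/negP: iK; rewrite (_ : ~: _ = A) //; apply/setP => x; rewrite !inE.
    have [->|xi] := eqVneq x i; first by rewrite (negPf iA).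
    by have [->|xj] := eqVneq x j; rewrite ?jA // sub'.
  - rewrite (_ : ~: _ = A) //; apply/setP => x; rewrite !inE.
    have [->|xi] := eqVneq x i; first by rewrite (negPf iA).
    have [->|xj] := eqVneq x j; first by rewrite (negPf jA).
    by rewrite sub'.
(* The numerical condition says that [K] without [x] and [y] is not a singleton. A point [v] of it
   is then separated from the pair by the complement of [v] and a further such point [z]. *)
have pairJ x y : x != y -> #|K| - (x \in K) - (y \in K) != 1 -> [set x; y] \in J.
  move=> xy cK; pose M := \bigcap_(A in J | [set x; y] \subset A) A.
  have MJ : M \in J by rewrite /M; elim/big_ind: _ => // A /andP[].
  rewrite (_ : [set x; y] = M) //; apply/eqP; rewrite eqEsubset; apply/andP; split.
    by apply/bigcapsP => A /andP[].
  apply/subsetP => v vM; apply/negPn/negP => vxy.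
  have sep A : A \in J -> [set x; y] \subset A -> v \in A.
    by move=> AJ sA; apply: (subsetP (bigcap_inf A _) v vM); rewrite AJ.
  have vxy' : (v != x) && (v != y) by move: vxy; rewrite !inE negb_or.
  have [vK|] := boolP (v \in K); last first.
    rewrite inE negbK => /sep; rewrite subUset !sub1set !inE eqxx.
    by case/andP: vxy' => vx vy; rewrite eq_sym vx eq_sym vy => /(_ isT).
  have cK' : #|K :\ x :\ y| = #|K| - (x \in K) - (y \in K).
    rewrite (cardsD1 x K) (cardsD1 y (K :\ x)) !inE eq_sym xy /=.
    by rewrite addKn addKn.
  have vK' : v \in K :\ x :\ y by case/andP: vxy' => vx vy; rewrite !inE vx vy; move: vK; rewrite inE.
  have [z zK zv] : exists2 z, z \in K :\ x :\ y & z \notin [set v].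
    apply: exists_notin; rewrite cards1 ltn_neqAle eq_sym cK' cK -cK'.
    by apply/card_gt0P; exists v.
  have /and3P[zy zx zK'] : [&& z != y, z != x & z \in K] by move: zK; rewrite in_setD1 in_setD1.
  rewrite inE in zv.
  have := sep _ (KK v z _ vK zK'); rewrite eq_sym zv => /(_ isT).
  rewrite subUset !sub1set !inE !negb_or eqxx /= => /(_ _) h.
  by case/andP: vxy' => vx vy; rewrite eq_sym vx eq_sym zx eq_sym vy eq_sym zy in h; have := h isT.
have two x y x' y' : x != y -> x' != y' -> [set x; y] != [set x'; y'] ->
    #|K| - (x \in K) - (y \in K) != 1 -> #|K| - (x' \in K) - (y' \in K) != 1 ->
    exists P Q, [/\ P \in J, Q \in J, P != Q, #|P| = 2 & #|Q| = 2].
  move=> xy xy' ne c c'; exists [set x; y], [set x'; y'].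
  by split; rewrite ?pairJ // cards2 ?xy ?xy'.
have neset x y y' : y != x -> y != y' -> [set x; y] != [set x; y'].
  move=> yx yy; apply/negP => /eqP/setP/(_ y).
  by rewrite !inE (negPf yx) (negPf yy) eqxx.
have pick3 (B : {set I}) : 3 <= #|B| -> exists x y z,
    [/\ x \in B, y \in B & z \in B] /\ [/\ y != x, y != z & x != z].
  move=> B3; have [x xB _] := @exists_notin _ B set0 ltac:(by rewrite cards0; lia).
  have [y yB] := @exists_notin _ B [set x] ltac:(by rewrite cards1; lia).
  have [z zB] := @exists_notin _ B [set x; y] ltac:(by rewrite cards2; lia).
  rewrite !inE negb_or => /andP[zx zy] yx; exists x, y, z; split=> //.
  by rewrite yx eq_sym zy eq_sym zx.
have leT n : n <= 4 -> n <= #|[set: I]| by move=> n4; rewrite cardsT; apply: leq_trans I4.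
(* The choice depends on [#|K|]. For 0 or at least 4 any pairs do; for 1, two pairs through the
   point of [K]; for 2, [K] and a pair outside it; for 3, two pairs joining a point outside [K] to
   points of [K]. *)
have [K4|K3] := leqP 4 #|K|.
  have [x [y [z [_ [yx yz xz]]]]] := pick3 setT (leT 3 isT).
  have K1 i j : #|K| - (i \in K) - (j \in K) != 1.
    by move: K4; case: (i \in K); case: (j \in K); move: #|K| => n; clear; lia.
  by apply: (two x y x z); rewrite ?K1 // ?neset // eq_sym.
have [K0|Kn] := eqVneq #|K| 0.
  have [x [y [z [_ [yx yz xz]]]]] := pick3 setT (leT 3 isT).
  by apply: (two x y x z); rewrite ?K0 // ?neset // eq_sym.
have [a aK _] := @exists_notin _ K set0 ltac:(by rewrite cards0; lia).
have [K1|Kn1] := eqVneq #|K| 1.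
  have nK i : i != a -> (i \in K) = false.
    move=> ia; apply/negP => iK; have : #|[set i; a]| <= #|K|.
      by apply: subset_leq_card; rewrite subUset !sub1set iK.
    by rewrite cards2 ia K1.
  have [x [y [_ [xa ya xy]]]] : exists x y, True /\ [/\ x != a, y != a & x != y].
    have [x _] := @exists_notin _ [set: I] [set a] ltac:(by rewrite cards1; apply: leT).
    have [y _] := @exists_notin _ [set: I] [set a; x] ltac:(by rewrite cards2; case: (_ != _); apply: leT).
    rewrite !inE negb_or => /andP[ya yx] xa; exists x, y; split=> //; split=> //.
    by rewrite eq_sym.
  by apply: (two a x a y); rewrite ?K1 ?aK ?nK // ?neset // eq_sym.
have [b bK] := @exists_notin _ K [set a] ltac:(by rewrite cards1; lia).
rewrite inE => ba.
have [K2|Kn2] := eqVneq #|K| 2.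
  have nK i : i != a -> i != b -> (i \in K) = false.
    move=> ia ib; apply/negP => iK; have : #|i |: [set a; b]| <= #|K|.
      by apply: subset_leq_card; rewrite !subUset !sub1set iK aK.
    by rewrite cardsU1 !inE negb_or ia ib cards2 eq_sym ba K2.
  have [x _] := @exists_notin _ [set: I] [set a; b] ltac:(by rewrite cards2; case: (_ != _); apply: leT).
  have [y _] := @exists_notin _ [set: I] (x |: [set a; b])
    ltac:(by rewrite cardsU1 cards2; case: (_ \notin _); case: (_ != _); apply: leT).
  rewrite !inE !negb_or => /and3P[yx ya yb] /andP[xa xb].
  apply: (two a b x y); rewrite 1?eq_sym //; last 2 first.
  - by rewrite K2 aK bK.
  - by rewrite K2 !nK.
  apply/negP => /eqP/setP/(_ a); rewrite !inE eqxx eq_sym.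
  by rewrite (negPf xa) eq_sym (negPf ya).
have [x _ xK] := @exists_notin _ [set: I] K (leq_trans K3 (leT 4 isT)).
have xa : x != a by apply: contraNneq xK => ->.
have xb : x != b by apply: contraNneq xK => ->.
have K3' i : i \in K -> #|K| - (x \in K) - (i \in K) != 1.
  by move=> ->; rewrite (negPf xK); move: Kn Kn1 Kn2 K3; move: #|K| => n; clear; lia.
by apply: (two x a x b); rewrite ?K3' // ?neset // eq_sym.
Qed.

Lemma uniform_tuple r (X : finType) (D : {set X}) :
  0 < r -> #|D| = r ->
  exists2 z : {ffun 'I_r -> X}, injective z & z @: [set: 'I_r] = D.
Proof.
move=> r0 cD; have /card_gt0P[x _] : 0 < #|D| by rewrite cD.
have [|||f [_ f2 f3]] := @ext_inj 'I_r X set0 setT D (fun=> x) (sub0set _).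
- by rewrite cardsT card_ord cD.
- by move=> u v; rewrite inE.
- by rewrite imset0 sub0set.
exists (finfun f); first by move=> u v; rewrite !ffunE; apply: f2; rewrite inE.
rewrite (_ : _ @: _ = f @: setT); last by apply: eq_imset => i; rewrite ffunE.
by rewrite (card_imset_in f2 f3) // cardsT card_ord.
Qed.

Lemma card_uniform_tuples r (X : finType) (F : {set {set X}}) :
  0 < r -> (forall D, D \in F -> #|D| = r) ->
  #|F| <= #|[set z : {ffun 'I_r -> X} | injectiveb z && (z @: [set: 'I_r] \in F)]|.
Proof.
move=> r0 unif; set T := [set z : {ffun _} | _].
apply: leq_trans (leq_imset_card (fun z : {ffun 'I_r -> X} => z @: [set: 'I_r]) T).
apply: subset_leq_card; apply/subsetP => D DF.
have [z injz zD] := uniform_tuple r0 (unif D DF).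
by apply/imsetP; exists z; rewrite // inE zD DF andbT; apply/injectiveP.
Qed.

(** After [stable_types], either no proper kernel contains all positions but some [i] and [j], and
    [card_no_kernel] leaves $O(n^{r-2})$ tuples, or [two_pairs_closed] applies to the common
    type. *)
Lemma kernel_pairs_or_few b r (X : finType) (F : {set {set X}}) :
  4 <= r -> uniform r F ->
  exists G : {set {ffun 'I_r -> X}},
    #|F| <= #|G| * #|{: {set {set 'I_r}}}| ^ #|{: {set 'I_r}}|.+2 /\
    (#|G| <= #|X| ^ (r - 2) * (r * b) ^ 2 \/
     exists P Q : {set 'I_r}, [/\ P != Q, #|P| = 2, #|Q| = 2 &
       forall z, z \in G -> [/\ injective z, z @: [set: 'I_r] \in F,
         z @: P \in pair_kernels b F & z @: Q \in pair_kernels b F]]).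
Proof.
move=> r4 /forall_inP unif.
have r0 : 0 < r by apply: leq_trans r4.
have leT := card_uniform_tuples r0 (fun D DF => eqP (unif D DF)).
set T := [set z : {ffun _} | _] in leT.
have [J leJ] := popular_type b T; set F1 := [set z in T | _] in leJ.
have s1 : F1 \subset T by apply/subsetP => z; rewrite inE => /andP[].
have t1 z : z \in F1 -> kernel_type b T z = J by rewrite inE => /andP[_ /eqP].
have [|G0 [G1 [G2 [J' [s21 s10 s0T [tG1 tG2] leG]]]]] :=
  @stable_types b _ _ #|{: {set 'I_r}}|.+1 T F1 J s1 t1.
  by rewrite ltnS max_card.
exists G2; split.
  apply: leq_trans leT _; apply: leq_trans leJ _.
  by rewrite expnSr mulnA leq_mul2r leG orbT.
have [cov|] := boolP [forall i, forall j, (i != j) ==>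
    [exists A in J', (A != setT) && (~: [set i; j] \subset A)]]; last first.
  case/forallPn => i /forallPn[j]; rewrite negb_imply => /andP[ij /exists_inPn no].
  left; have := @card_no_kernel b 'I_r X G0 (~: [set i; j]).
  have c2 : #|[set i; j]| = 2 by rewrite cards2 ij.
  rewrite setCK c2 card_ord.
  have -> : #|~: [set i; j]| = r - 2.
    by have := cardsC [set i; j]; rewrite c2 card_ord; lia.
  apply: leq_trans; apply: leq_trans (subset_leq_card s21) _.
  apply: subset_leq_card; apply/subsetP => z zG1; rewrite inE (subsetP s10 z zG1) /=.
  apply/forallP => B; apply/implyP => /andP[sB BT].
  apply/negP => kB; have := no B; rewrite -(tG1 z zG1) inE kB => /(_ isT).
  by rewrite BT sB.
have [->|/set0Pn[z0 z0G2]] := eqVneq G2 set0; first by left; rewrite cards0.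
right.
have z0G1 := subsetP s21 _ z0G2.
have [||||P [Q [PJ QJ PQ cP cQ]]] := @two_pairs_closed 'I_r J'.
- by rewrite card_ord.
- by rewrite -(tG2 z0 z0G2) inE; apply: tuple_kernelT.
(* This is why three nested families with one type are needed: [A] is a kernel for [G1] at [z0], and
   [B] one for [G0] at every tuple of [G1]. *)
- move=> A B; rewrite -{1}(tG2 z0 z0G2) inE => kA BJ.
  rewrite -(tG1 z0 z0G1) inE; apply: tuple_kernelI kA _ => y yG1.
  by move: BJ; rewrite -(tG1 y yG1) inE.
- move=> i j ij; move/forallP/(_ i)/forallP/(_ j): cov; rewrite ij.
  by case/exists_inP => A AJ h; exists A.
exists P, Q; split=> // z zG2.
have zG1 := subsetP s21 _ zG2.
have zT : z \in T by apply: (subsetP s0T); apply: (subsetP s10).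
have [injz zF] : injective z /\ z @: [set: 'I_r] \in F.
  by move: zT; rewrite inE => /andP[/injectiveP].
have ker R : R \in J' -> #|R| = 2 -> z @: R \in pair_kernels b F.
  move=> RJ cR; rewrite inE card_imset // cR eqxx /=.
  apply/forallP => Y; apply/implyP => Yb.
  move: RJ; rewrite -(tG1 z zG1) inE => /tuple_kernelP/(_ Y Yb)[y yG0 [y1 y2]].
  have := subsetP s0T y yG0; rewrite inE => /andP[_ yF].
  apply/exists_inP; exists (y @: [set: 'I_r]) => //.
  rewrite -(eq_in_imset y1) imsetS ?subsetT //=.
  rewrite -setI_eq0; apply/eqP/setP => x; rewrite !inE; apply/negP.
  case/andP => /andP[xR /imsetP[i _ ex]] xY.
  have iR : i \notin R by apply: contraNN xR => iR; rewrite ex imset_f.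
  by move: (y2 i iR); rewrite -ex xY.
by split=> //; apply: ker.
Qed.

Section PairCount.

Variables (X : finType) (G : {set {set X}}).
Hypothesis G2 : forall P, P \in G -> #|P| = 2.

Definition adj_pairs : {set X * X} := [set p | [set p.1; p.2] \in G].

Definition adj_deg (a : X) : nat := #|[set c | [set a; c] \in G]|.

Lemma card_adj_pairs : #|adj_pairs| <= #|G| * 4.
Proof.
apply: (fiber_bound (f := fun p : X * X => [set p.1; p.2])) => [p|P PG].
  by rewrite inE.
have e : 4 = #|setX P P| by rewrite cardsX G2.
rewrite e; apply: subset_leq_card; apply/subsetP => -[a c].
by rewrite !inE => /andP[_ /eqP <-]; rewrite !inE !eqxx orbT.
Qed.

Lemma card_adj_high n d : 0 < n ->
  #|[set a | n < d * adj_deg a]| * n <= d * #|adj_pairs|.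
Proof.
move=> n0; set W := [set a | _].
have e : #|adj_pairs| = \sum_a adj_deg a.
  rewrite -sum1_card (partition_big (fun p : X * X => p.1) xpredT) //=.
  apply: eq_bigr => a _; rewrite sum1_card /adj_deg.
  rewrite -[RHS](card_imset _ (f := fun c => (a, c))); last by move=> c c' [].
  apply: eq_card => -[x y]; rewrite unfold_in; apply/andP/imsetP => /= [[xy /eqP ex]|[c]].
    by exists y; rewrite ?ex // inE -ex; rewrite inE in xy.
  by rewrite !inE => ac [-> ->]; rewrite eqxx.
rewrite e big_distrr /= -sum_nat_const.
apply: (@leq_trans (\sum_(a in W) d * adj_deg a)).
  by apply: leq_sum => a; rewrite inE; apply: ltnW.
rewrite [X in _ <= X](bigID (mem W)) /=; exact: leq_addr.
Qed.

(** A cherry is an ordered edge followed by a further neighbour of its first vertex, possibly the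
    same one. Only centers of degree at most [n / d] count, so each ordered edge has at most [n / d]
    continuations. *)
Lemma card_cherries n d :
  #|[set p : X * X * X | [&& (d * adj_deg p.1.1 <= n), p.1 \in adj_pairs &
       (p.1.1, p.2) \in adj_pairs]]| * d <= #|adj_pairs| * n.
Proof.
have [->|d0] := posnP d; first by rewrite muln0.
set Z := [set p | _].
have : #|Z| <= #|adj_pairs| * (n %/ d).
  apply: (fiber_bound (f := fun p : X * X * X => p.1)) => [p|[a c] _].
    by rewrite inE => /and3P[].
  set Z' := [set z in Z | _].
  have [->|/set0Pn[p]] := eqVneq Z' set0; first by rewrite cards0.
  rewrite !inE /= => /andP[/and3P[dn _ _] /eqP ep]; rewrite ep /= in dn.
  rewrite leq_divRL // mulnC; apply: leq_trans dn; rewrite leq_mul2l; apply/orP; right.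
  rewrite /adj_deg -[leqRHS](card_imset _ (f := fun x => (a, c, x))); last by move=> x y [].
  apply: subset_leq_card; apply/subsetP => -[[x y] u]; rewrite !inE /=.
  case/andP => /and3P[_ _ xu] /eqP[ex ey]; apply/imsetP; exists u; rewrite ?inE -?ex -?ey //.
move=> le; apply: (@leq_trans (#|adj_pairs| * (n %/ d) * d)).
  by rewrite leq_mul2r le orbT.
by rewrite -mulnA leq_mul2l leq_trunc_div orbT.
Qed.

End PairCount.

(** * Almost all edges meet a bounded set *)

Lemma pair_kernelsS b (X : finType) (F F' : {set {set X}}) :
  F \subset F' -> pair_kernels b F \subset pair_kernels b F'.
Proof.
move=> sub; apply/subsetP => P; rewrite !inE => /andP[-> /forallP ker] /=.
apply/forallP => Y; apply/implyP => /(implyP (ker Y))/exists_inP[D DF h].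
by apply/exists_inP; exists D => //; apply: (subsetP sub).
Qed.

Lemma card_by_coords (I X Q : finType) (f : {ffun I -> X} -> Q) (A : {set I})
    (B : {set Q}) (G : {set {ffun I -> X}}) :
  (forall z, z \in G -> f z \in B) -> (forall y z, f y = f z -> {in A, y =1 z}) ->
  #|G| <= #|B| * #|X| ^ #|~: A|.
Proof.
move=> fB fA; apply: (fiber_bound fB) => p _; set Z := [set z in G | _].
have [->|/set0Pn[z0]] := eqVneq Z set0; first by rewrite cards0.
rewrite inE => /andP[_ /eqP e0]; apply: leq_trans (card_agree A z0).
apply: subset_leq_card; apply/subsetP => z; rewrite !inE => /andP[_ /eqP ez].
by apply/forall_inP => i iA; apply/eqP/(fA z z0) => //; rewrite ez e0.
Qed.

Lemma pair_with (T : finType) (P : {set T}) x :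
  #|P| = 2 -> x \in P -> exists2 y, y != x & P = [set x; y].
Proof.
move=> cP xP; have /cards1P[y e] : #|P :\ x| == 1.
  by move: cP; rewrite (cardsD1 x) xP add1n => -[->].
exists y; last by rewrite -e setD1K.
by have := set11 y; rewrite -e !inE => /andP[].
Qed.

(** If too many edges missed [W], the set of vertices in more than [n / d] kernel pairs, many tuples
    would have kernel pairs at two fixed pairs of positions. Disjoint pairs allow $O(n^2)\,n^{r-4}$
    tuples; pairs sharing a position form cherries centered outside [W], allowing
    $O(n^2/d)\,n^{r-3}$. *)
Lemma few_uncentered r (V : finType) (H : {set {set V}}) (s : seq {set V}) q :
  4 <= r -> uniform r H -> reducible (r - 2) H -> tree_ordering H s -> H != set0 ->
  exists w0 n0, forall (X : finType) (F : {set {set X}}),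
    n0 <= #|X| -> uniform r F -> ~~ contains H F ->
    exists2 W : {set X}, #|W| <= w0 &
      q * #|[set D in F | [disjoint D & W]]| <= #|X| ^ (r - 1).
Proof.
move=> r4 unifH red tree H0; have r2 : 2 <= r by apply: leq_trans r4.
pose b := #|V|; pose K := #|V| * #|H|.+1.
pose c := #|{: {set {set 'I_r}}}| ^ #|{: {set 'I_r}}|.+2.
(* [d] exceeds the factor lost in the cherry count, so that this count contradicts [bigT]. *)
pose d := (q * c * (K * 4)).+1.
exists (d * (K * 4)), (#|V| + q * c * (r * b) ^ 2 + q * c * (K * 4) ^ 2).+1.
move=> X F; set n := #|X| => nn0 unifF noH.
have n0 : 0 < n by apply: leq_trans nn0.
pose G := pair_kernels b F.
have G2 P : P \in G -> #|P| = 2 by rewrite inE => /andP[/eqP].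
have cG : #|G| <= K * n.
  by apply: (pair_kernels_le r2 unifH red unifF _ tree H0 noH); move: nn0; rewrite -/n; lia.
have cadj : #|adj_pairs G| <= K * 4 * n.
  apply: leq_trans (card_adj_pairs G2) _; rewrite -mulnA (mulnC 4) mulnA.
  by rewrite leq_mul2r cG.
pose W := [set a | n < d * adj_deg G a].
exists W.
  rewrite -(leq_pmul2r n0); apply: leq_trans (card_adj_high G d n0) _.
  by rewrite -mulnA leq_mul2l cadj orbT.
set F0 := [set D in F | _]; rewrite leqNgt; apply/negP => big.
have sF0 : F0 \subset F by apply/subsetP => D; rewrite inE => /andP[].
have unif0 : uniform r F0.
  by apply/forall_inP => D /(subsetP sF0); apply: (forall_inP unifF).
have [T [leF dich]] := kernel_pairs_or_few b r4 unif0; rewrite -/c in leF.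
pose e := n ^ (r - 4); have e0 : 0 < e by rewrite expn_gt0 n0.
have n1 : n ^ (r - 1) = n * n * n * e.
  by rewrite /e -?mulnA -!expnS; congr (_ ^ _); lia.
have n2 : n ^ (r - 2) = n * n * e by rewrite /e -?mulnA -!expnS; congr (_ ^ _); lia.
have n3 : n ^ (r - 3) = n * e by rewrite /e -?mulnA -!expnS; congr (_ ^ _); lia.
have bigT : n * n * n * e < q * c * #|T|.
  rewrite -n1; apply: leq_trans big _; rewrite -mulnA leq_mul2l mulnC leF orbT //.
have n2e : 0 < n * n * e by rewrite !muln_gt0 n0 e0.
case: dich => [few|[P [Q [PQ cP cQ zT]]]].
  have : n * (n * n * e) < q * c * (r * b) ^ 2 * (n * n * e).
    rewrite -[q * c * _ * _]mulnA (mulnC ((r * b) ^ 2)) -n2.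
    have -> : n * n ^ (r - 2) = n * n * n * e by rewrite n2 !mulnA.
    by apply: leq_trans bigT _; rewrite leq_mul2l few orbT.
  rewrite ltn_pmul2r //; move: nn0; rewrite -/n.
  by move: (_ * (r * b) ^ 2) (_ * (K * 4) ^ 2) #|V|; clear; lia.
have sG0 : pair_kernels b F0 \subset G by apply: pair_kernelsS.
have zadj z x y : z \in T -> P = [set x; y] \/ Q = [set x; y] ->
    (z x, z y) \in adj_pairs G.
  move=> /zT[_ _ zP zQ] xy; rewrite inE /= -!imset_set1 -imsetU.
  by case: xy => <-; apply: (subsetP sG0).
have [PQ0|/set0Pn[x /setIP[xP xQ]]] := eqVneq (P :&: Q) set0.
  have /cards2P[x [y [xy eP]]] : #|P| == 2 by rewrite cP.
  have /cards2P[x' [y' [xy' eQ]]] : #|Q| == 2 by rewrite cQ.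
  have cPQ : #|~: (P :|: Q)| = r - 4.
    by have := cardsC (P :|: Q); rewrite cardsU PQ0 cards0 cP cQ card_ord; move: r4 #|~: _|; clear; lia.
  have leT : #|T| <= #|setX (adj_pairs G) (adj_pairs G)| * e.
    rewrite /e -cPQ.
    apply: (@card_by_coords _ X _ (fun z => ((z x, z y), (z x', z y')))) => [z zT'|y1 z].
      by rewrite in_setX !zadj //; [right|left].
    case=> e1 e2 e3 e4 i; rewrite eP eQ !inE -orbA.
    by case/or4P => /eqP->.
  rewrite cardsX in leT.
  have : n * (n * n * e) < q * c * (K * 4) ^ 2 * (n * n * e).
    rewrite !(mulnA n); apply: leq_trans bigT _.
    rewrite -(mulnA (q * c)) leq_mul2l; apply/orP; right; apply: leq_trans leT _.
    by rewrite mulnA leq_mul2r -mulnn mulnACA leq_mul ?orbT.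
  rewrite ltn_pmul2r //; move: nn0; rewrite -/n.
  by move: (_ * (r * b) ^ 2) (_ * (K * 4) ^ 2) #|V|; clear; lia.
have [y yx eP] := pair_with cP xP; have [y' yx' eQ] := pair_with cQ xQ.
have yy' : y != y' by apply: contraNneq PQ => yy; rewrite eP eQ yy.
have cA : #|~: [set x; y; y']| = r - 3.
  have := cardsC [set x; y; y']; rewrite setUC cardsU1 !inE cards2 card_ord.
  by rewrite negb_or yx' (eq_sym y' y) yy' (eq_sym x) yx; move: r4 #|~: _|; clear; lia.
have := card_cherries G n d; set Ch := [set p : X * X * X | _]; set ch := #|Ch| => le1.
have le2 : #|T| <= ch * (n * e).
  rewrite -n3 -cA.
  apply: (@card_by_coords _ X _ (fun z => ((z x, z y), z y'))) => [z zT'|y1 z].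
    rewrite inE /=; apply/and3P; split; [|by apply: zadj => //; left|by apply: zadj => //; right].
    have [_ zF _ _] := zT z zT'; move: zF; rewrite inE => /andP[_ dW].
    have := disjointFr dW (imset_f z (in_setT x)); rewrite inE.
    by move/negbT; rewrite -leqNgt.
  by case=> e1 e2 e3 i; rewrite !inE -orbA => /or3P[] /eqP->.
have : q * c * (K * 4) * (n * n * n * e) + n * n * n * e <= q * c * (K * 4) * (n * n * n * e).
  have -> : q * c * (K * 4) * (n * n * n * e) + n * n * n * e = n * n * n * e * d.
    by rewrite /d mulnS addnC [in RHS]mulnC.
  apply: (@leq_trans (q * c * #|T| * d)); first by rewrite leq_mul2r ltnW ?orbT.
  apply: (@leq_trans (q * c * (ch * d * (n * e)))).
    by rewrite -[X in X <= _]mulnA leq_mul2l; apply/orP; right; rewrite mulnAC leq_mul2r le2 orbT.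
  have -> : q * c * (K * 4) * (n * n * n * e) = q * c * (K * 4 * n * n * (n * e)) by rewrite -!mulnA.
  rewrite leq_mul2l; apply/orP; right; rewrite leq_mul2r; apply/orP; right.
  by apply: leq_trans le1 _; rewrite leq_mul2r cadj orbT.
have : 0 < n * n * n * e by rewrite !muln_gt0 n0 e0.
by move: (n * n * n * e) (_ * (K * 4)); clear; lia.
Qed.

(** * Stability *)

Lemma bin_le_expn n m : 'C(n, m) <= n ^ m.
Proof.
case: m => [|m]; first by rewrite bin0.
have unif (D : {set 'I_n}) : D \in [set D : {set 'I_n} | #|D| == m.+1] -> #|D| = m.+1.
  by rewrite inE => /eqP.
have := card_uniform_tuples (ltn0Sn m) unif; rewrite card_draws card_ord.
move=> le; apply: leq_trans le _; apply: leq_trans (max_card _) _.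
by rewrite card_ffun !card_ord.
Qed.

Lemma card_supersets (X : finType) k (Z : {set X}) :
  #|[set A : {set X} | (#|A| == k) && (Z \subset A)]| <= #|X| ^ (k - #|Z|).
Proof.
apply: leq_trans (bin_le_expn _ _); rewrite -card_draws.
rewrite -(card_in_imset (f := fun A => A :\: Z)); last first.
  move=> A B; rewrite !inE => /andP[_ sA] /andP[_ sB] e.
  by rewrite -[LHS](setID _ Z) -[RHS](setID _ Z) (setIidPr sA) (setIidPr sB) e.
apply: subset_leq_card; apply/subsetP => _ /imsetP[A AZ ->].
by move: AZ; rewrite inE => /andP[/eqP cA sA]; rewrite inE cardsDS // cA.
Qed.

Lemma card_shadow (X : finType) k (A : {set {set X}}) :
  (forall E, E \in A -> #|E| = k) -> #|shadow A| <= #|X| ^ (k - 1).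
Proof.
move=> unif; apply: leq_trans (bin_le_expn _ _); rewrite -card_draws.
apply: subset_leq_card; apply/bigcupsP => E EA; apply/subsetP => _ /imsetP[a aE ->].
by rewrite inE -(unif E EA) (cardsD1 a E) aE addKn.
Qed.

Lemma bin_sub_ge n t k : t <= n -> t * 'C(n - t, k) <= 'C(n, k.+1) - 'C(n - t, k.+1).
Proof.
move=> tn; rewrite -{2}(subnK tn); move: (n - t) => m; rewrite leq_subRL; last first.
  by apply: leq_bin2l; apply: leq_addr.
elim: t {tn} => [|t IH]; first by rewrite mul0n !addn0.
rewrite addnS binS mulSn; have := leq_bin2l k (leq_addr t m); move: IH; lia.
Qed.

Lemma bin_sub_le n t k : t <= n -> 'C(n, k) <= 'C(n - t, k) + t * n ^ (k - 1).
Proof.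
move=> tn; have : n - t + t <= n by rewrite subnK.
rewrite -[in 'C(n, k)](subnK tn); move: (n - t) => m; elim: t {tn} => [|t IH] le.
  by rewrite mul0n !addn0.
case: k IH => [|k] IH; first by rewrite !bin0.
rewrite addnS binS mulSn subSS subn0.
have : 'C(m + t, k) <= n ^ k.
  by apply: leq_trans (bin_le_expn _ _) _; case: (posnP k) => [->//|k0]; rewrite leq_exp2r //; lia.
have : m + t <= n by lia.
move=> /IH; rewrite subSS subn0; lia.
Qed.

Lemma card_noninjective k (X : finType) :
  #|[set a : {ffun 'I_k -> X} | ~~ injectiveb a]| <= k * k * #|X| ^ (k - 1).
Proof.
pose P := [set p : 'I_k * 'I_k | p.1 != p.2].
have sub : [set a : {ffun 'I_k -> X} | ~~ injectiveb a] \subset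
    \bigcup_(p in P) [set a : {ffun 'I_k -> X} | a p.1 == a p.2].
  apply/subsetP => a; rewrite inE => /injectivePn[i [j ij e]].
  apply/bigcupP; exists (i, j); rewrite !inE ?e ?eqxx //=; by rewrite eq_sym in ij *.
apply: leq_trans (subset_leq_card sub) _; apply: leq_trans (card_bigcup_le _ _) _.
apply: (@leq_trans (\sum_(p in P) #|X| ^ (k - 1))); last first.
  rewrite sum_nat_const leq_mul2r; apply/orP; right.
  by apply: leq_trans (max_card _) _; rewrite card_prod card_ord.
apply: leq_sum => -[i j]; rewrite inE /= => ij; set Z := [set a | _].
have [->|/set0Pn[a0 _]] := eqVneq Z set0; first by rewrite cards0.
pose f (a : {ffun 'I_k -> X}) := [ffun l => if l == j then a0 j else a l].
rewrite -(card_in_imset (f := f)); last first.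
  move=> a b; rewrite !inE => /eqP ea /eqP eb /ffunP e; apply/ffunP => l.
  have [->|lj] := eqVneq l j.
    by move: (e i); rewrite !ffunE (negPf ij) ea eb.
  by move: (e l); rewrite !ffunE (negPf lj).
have := card_agree [set j] a0; rewrite cardsC1 card_ord subn1; apply: leq_trans.
apply: subset_leq_card; apply/subsetP => _ /imsetP[a _ ->]; rewrite inE.
by apply/forall_inP => l; rewrite inE => /eqP->; rewrite ffunE eqxx.
Qed.

Lemma card_tuples_image k (X : finType) (Unc : {set {set X}}) :
  (forall D, D \in Unc -> #|D| <= k) ->
  #|[set a : {ffun 'I_k -> X} | a @: [set: 'I_k] \in Unc]| <= #|Unc| * k ^ k.
Proof.
move=> unif; apply: (fiber_bound (f := fun a : {ffun 'I_k -> X} => a @: [set: 'I_k])) => [a|D DU].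
  by rewrite inE.
apply: (@leq_trans (#|D| ^ k)); last first.
  by have [->//|k0] := posnP k; rewrite leq_exp2r // unif.
rewrite -[in X in _ ^ X](card_ord k) -(card_ffun_on 'I_k (mem D)); apply: subset_leq_card.
apply/subsetP => a; rewrite !inE => /andP[_ /eqP <-].
by apply/ffun_onP => i; rewrite imset_f.
Qed.

Definition hybrid k (X : finType) (j : nat) (a a' : {ffun 'I_k -> X}) :
    {ffun 'I_k -> X} :=
  [ffun i : 'I_k => if i < j then a' i else a i].

(** Averaging over [a]. For fixed [j], exchanging the first [j] coordinates of two tuples is
    injective on pairs of tuples, so the [j]-th hybrid lies in [UT] for at most [#|UT|] pairs per
    tuple on average; there are [k.+1] values of [j]. *)
Lemma hybrid_good k (X : finType) (UT : {set {ffun 'I_k -> X}}) :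
  0 < #|X| ->
  exists a, #|[set a' | [exists j : 'I_k.+1, hybrid j a a' \in UT]]| <= k.+1 * #|UT|.
Proof.
move=> X0; pose T := {ffun 'I_k -> X}.
pose Bad (a : T) := [set a' | [exists j : 'I_k.+1, hybrid j a a' \in UT]].
apply/existsP; apply: contraT; rewrite negb_exists => /forallP no.
pose Z := [set p : T * T | p.2 \in Bad p.1].
have cZ : #|Z| = \sum_a #|Bad a|.
  rewrite -sum1_card (partition_big (fun p : T * T => p.1) xpredT) //=.
  apply: eq_bigr => a _; rewrite sum1_card.
  rewrite -[RHS](card_imset _ (f := fun c => (a, c))); last by move=> c c' [].
  apply: eq_card => -[x y]; rewrite unfold_in; apply/andP/imsetP => /= [[xy /eqP ex]|[c]].
    by exists y; rewrite ?ex // -ex; rewrite inE in xy.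
  by move=> cB [-> ->]; rewrite inE.
have up : #|Z| <= k.+1 * #|UT| * #|{: T}|.
  pose Zj (j : 'I_k.+1) := [set p : T * T | hybrid j p.1 p.2 \in UT].
  have sub : Z \subset \bigcup_(j in [set: 'I_k.+1]) Zj j.
    apply/subsetP => p; rewrite !inE => /existsP[j h]; apply/bigcupP; exists j => //.
    by rewrite inE.
  apply: leq_trans (subset_leq_card sub) _; apply: leq_trans (card_bigcup_le _ _) _.
  apply: (@leq_trans (\sum_(j in [set: 'I_k.+1]) #|UT| * #|{: T}|)); last first.
    by rewrite sum_nat_const cardsT card_ord mulnA.
  apply: leq_sum => j _; rewrite -[X in _ * X]cardsT -cardsX.
  rewrite -(card_imset _ (f := fun p => (hybrid j p.1 p.2, hybrid j p.2 p.1))); last first.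
    move=> [a b] [c d] /= [/ffunP e1 /ffunP e2]; congr pair; apply/ffunP => i;
    by move: (e1 i) (e2 i); rewrite !ffunE; case: ifP.
  apply: subset_leq_card; apply/subsetP => _ /imsetP[p pZ ->].
  by rewrite !inE /= andbT; rewrite inE in pZ.
have lo : \sum_(a : T) (k.+1 * #|UT|).+1 <= #|Z|.
  by rewrite cZ; apply: leq_sum => a _; rewrite ltnNge no.
have T0 : 0 < #|{: T}| by rewrite card_ffun expn_gt0 X0.
move: (leq_trans lo up); rewrite sum_nat_const mulnC leq_pmul2r //.
by rewrite ltnn.
Qed.

(** Any earlier set serves as parent. This is meant for the edges of a star with the center
    removed. *)
Lemma tree_seq_disjoint (V : finType) (l : seq {set V}) :
  uniq l -> (forall E D v, E \in l -> D \in l -> E != D -> v \in E -> v \notin D) ->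
  tree_seq l.
Proof.
elim: l => //= E l IH /andP[El ul] dis; split.
  by apply: IH => // B D v Bl Dl; apply: dis; rewrite inE ?Bl ?Dl orbT.
case: l El dis {IH ul} => [|D l] El dis; [by left|right].
exists D; first exact: mem_head.
apply/subsetP => v /setIP[vE /cover_seqP[B Bl vB]].
have EB : E != B by apply: contraNneq El => ->.
have Bl' : B \in E :: D :: l by rewrite inE Bl orbT.
by have := dis E B v (mem_head _ _) Bl' EB vE; rewrite vB.
Qed.

Lemma card_set_sum (T : finType) (A : {set T}) (P : pred T) :
  #|[set x in A | P x]| = \sum_(x in A) P x.
Proof.
rewrite -sum1_card (eq_bigl (fun x => (x \in A) && P x)); last first.
  by move=> x; rewrite inE.
by rewrite big_mkcondr; apply: eq_bigr => x _; case: (P x).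
Qed.

Section Stability.

Variables (k t : nat) (V : finType) (H : {set {set V}}) (S : {set V}) (w : V).
Variables (s q : seq {set V}) (D0 Ea : {set V}).
Hypotheses (k3 : 3 <= k) (unifH : uniform k.+1 H) (redH : reducible (k.+1 - 2) H).
Hypotheses (treeH : tree_ordering H s) (cutS : cross_cut H S) (wS : w \in S).
Hypotheses (cardS : #|S| = t.+1) (tq : tree_seq q) (size_q : size q <= #|H|).
Hypothesis qH : q =i [set E in H | w \notin E].
Hypotheses (D0w : D0 \in edges_at H w) (Eaq : Ea \in q).
Hypothesis attach : forall v E D, E \in q -> D \in edges_at H w ->
  v \in E -> v \in D -> v \in D0 :&: Ea.
Hypothesis cardA : #|D0 :&: Ea| <= 2.
Hypothesis starw : forall D D' v, D \in edges_at H w -> D' \in edges_at H w ->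
  D != D' -> v \in D -> v \in D' -> v = w.

(** [w] goes to a point [c'] of [U'] outside [U], and the rest of its star into members of [A']. The
    at most two points of [D0 :&: Ea] go into [B :&: B'], so [attach_star] can complete the copy
    with [A] and [U]. *)
Lemma no_common_pair (X : finType) (F : {set {set X}}) (W U U' : {set X})
    (A A' : {set {set X}}) (B B' : {set X}) :
  #|V| <= #|X| -> U \subset W -> U' \subset W -> #|U| = t -> #|U'| = t -> U != U' ->
  clean (#|V| * #|H|.+3) k A -> clean (#|V| * #|H|.+3) k A' ->
  (forall C, C \in A -> [disjoint C & W]) -> (forall C, C \in A' -> [disjoint C & W]) ->
  (forall C c, C \in A -> c \in U -> c |: C \in F) ->
  (forall C c, C \in A' -> c \in U' -> c |: C \in F) ->
  B \in A -> B' \in A' -> 2 <= #|B :&: B'| -> contains H F.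
Proof.
move=> VX UW UW' cU cU' neU clA clA' AW AW' AF AF' BA BA' cB.
have [c' c'U' c'U] : exists2 c', c' \in U' & c' \notin U.
  have /subsetPn[c' c1 c2] : ~~ (U' \subset U).
    by apply: contra neU => sub; rewrite eq_sym eqEcard sub cU cU' leqnn.
  by exists c'.
have wEa : w \notin Ea by move: Eaq; rewrite qH inE => /andP[].
have [wD0 D0H] : w \in D0 /\ D0 \in H by move: D0w; rewrite inE => /andP[].
have /set0Pn[x0 _] : B :&: B' != set0 by rewrite -card_gt0; apply: leq_trans cB.
have [||||phi0 [_ i0 sub0]] := @ext_inj V X set0 (D0 :&: Ea) (B :&: B') (fun=> x0).
- exact: sub0set.
- exact: leq_trans cB.
- by move=> u v; rewrite inE.
- by rewrite imset0 sub0set.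
have cB' : #|B'| = k by rewrite clA'.1.
have cE E : E \in edges_at H w -> #|E :\ w| = k.
  rewrite inE => /andP[EH wE]; have := eqP (forall_inP unifH E EH).
  by rewrite (cardsD1 w) wE add1n => -[].
have [||||phi [p1 p2 p3]] := @ext_inj V X (D0 :&: Ea) (D0 :\ w) B' phi0.
- apply/subsetP => v /setIP[vD vE]; rewrite !inE vD andbT.
  by apply: contraNneq wEa => <-.
- by rewrite cE // cB'.
- done.
- by apply: subset_trans sub0 (subsetIr _ _).
have phiB : phi @: (D0 :\ w) = B' by rewrite (card_imset_in p2 p3) // cE // cB'.
pose l := [seq E :\ w | E <- enum (edges_at H w)].
have lP E : E \in edges_at H w -> E :\ w \in l by move=> Ew; apply: map_f; rewrite mem_enum.
have tl : tree_seq l.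
  apply: tree_seq_disjoint.
    rewrite map_inj_in_uniq ?enum_uniq // => D D'; rewrite !mem_enum !inE.
    by move=> /andP[_ wD] /andP[_ wD'] e; rewrite -(setD1K wD) -(setD1K wD') e.
  move=> _ _ v /mapP[E + ->] /mapP[D + ->]; rewrite !mem_enum => Ew Dw ne.
  rewrite !inE => /andP[vw vE]; apply/negP => /andP[_ vD].
  case/eqP: vw; apply: (starw Ew Dw) => //; by apply: contraNneq ne => ->.
have [|||||f [f1 [f2 f3] _]] := @tree_embedding _ _ V X A' l (D0 :\ w) phi set0 clA' tl _ _ p2.
- by move=> _ /mapP[E + ->]; rewrite mem_enum; apply: cE.
- exact: lP.
- by rewrite phiB.
- by rewrite disjoint_sym disjoints_subset sub0set.
- rewrite cards0 leq_mul2l size_map -cardE; apply/orP; right; rewrite ltnS.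
  apply: leq_trans (leqW (leqnSn _)); apply: subset_leq_card.
  by apply/subsetP => E; rewrite inE => /andP[].
pose h v := if v == w then c' else f v.
have hw : h w = c' by rewrite /h eqxx.
have hf v : v != w -> h v = f v by rewrite /h => /negPf->.
have covl v : v \in cover (edges_at H w) -> v != w ->
    exists2 E, E \in edges_at H w & v \in E :\ w.
  by case/coverP => E Ew vE vw; exists E; rewrite // !inE vw.
have fW v : v \in cover (edges_at H w) -> v != w -> f v \notin W.
  move=> vc vw; have [E Ew vE] := covl v vc vw.
  by rewrite (disjointFr (AW' _ (f3 _ (lP E Ew)))) // imset_f.
have c'W : c' \in W by apply: (subsetP UW').
have lcov v : v \in cover (edges_at H w) -> v != w -> v \in cover_seq l.
  by move=> vc vw; have [E Ew vE] := covl v vc vw; apply/cover_seqP; exists (E :\ w); rewrite ?lP.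
apply: (attach_star unifH cutS wS cardS tq size_q qH D0w Eaq attach (F := F) VX cU clA
         (h := h) _ AF _ _ _ BA).
- move=> C CA; apply: disjointWr (AW C CA); exact: UW.
- move=> u v uc vc; have [->|uw] := eqVneq u w; have [->|vw] := eqVneq v w => //.
  + by rewrite hw hf // => e; case/negP: (fW v vc vw); rewrite -e.
  + by rewrite hw hf // => e; case/negP: (fW u uc uw); rewrite e.
  + by rewrite !hf // => e; apply: f2 => //; apply: lcov.
- move=> E Ew; have wE : w \in E by move: Ew; rewrite inE => /andP[].
  rewrite -{1}(setD1K wE) imsetU1 hw (@eq_in_imset _ _ h f).
    by apply: AF' => //; apply: f3; apply: lP.
  by move=> v; rewrite !inE => /andP[vw _]; apply: hf.
- move=> v vc; have [->|vw] := eqVneq v w; first by rewrite hw.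
  by rewrite hf //; apply: contra (fW v vc vw); apply: subsetP.
apply/subsetP => _ /imsetP[v vA ->].
have vw : v != w by case/setIP: vA => _ vE; apply: contraNneq wEa => <-.
have vD : v \in D0 :\ w by case/setIP: vA => vD _; rewrite !inE vw.
rewrite hf // f1 // p1 //.
by have /setIP[] := subsetP sub0 _ (imset_f phi0 vA).
Qed.

(** Few $k$-sets have more than $t$ neighbours in [W], so the size of [F] forces few to have less
    than $t$. Walks through hybrids then carry a single [T] to almost all $k$-sets. *)
Lemma stability e :
  exists n0, forall (X : finType) (F : {set {set X}}),
    n0 <= #|X| -> uniform k.+1 F -> ~~ contains H F ->
    'C(#|X|, k.+1) - 'C(#|X| - t, k.+1) <= #|F| ->
    exists2 T : {set X}, #|T| = t &
      e * #|[set D : {set X} | [&& #|D| == k.+1, ~~ [disjoint D & T] & D \notin F]]|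
        <= #|X| ^ k.
Proof.
have k0 : 0 < k by apply: leq_trans k3.
have H0 : H != set0.
  by apply/set0Pn; exists D0; move: D0w; rewrite inE => /andP[].
(* [z] dominates the factor [e * t * k.+1] of the final count and exceeds [k.+1], which leaves a
   tuple that is not bad. *)
pose N := #|V| * #|H|.+3; pose z := t.+1 * k.+1 * e.+2.
have [w0 [m0 few]] :=
  @few_uncentered k.+1 V H s (2 * z * k ^ k) k3 unifH redH treeH H0.
pose C0 := k * k + k ^ k * (w0 + 2 ^ w0 * N + t * t + w0 * w0 + w0 * (2 ^ w0 * N)).
exists (m0 + t + #|V| + 2 * z * C0).+1 => X F; set n := #|X| => nn0 unifF noH leF.
have [n_gt0 nm0 nt nV nC] : [/\ 0 < n, m0 <= n, t <= n, #|V| <= n & 2 * z * C0 <= n].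
  by split; move: nn0; move: #|V| (2 * z * C0); clear; lia.
have [W cW leF0] := few X F nm0 unifF noH.
set F0 := [set D in F | _] in leF0.
rewrite subn1 /= in leF0.
pose M := n ^ (k - 1).
have nk : n ^ k = n * M by rewrite /M -expnS subn1 prednK.
pose Om := [set A : {set X} | (#|A| == k) && [disjoint A & W]].
pose nb (A : {set X}) := [set c in W | c |: A \in F].
pose fam (U : {set X}) := [set A in Om | U \subset nb A].
have unifam U A : A \in fam U -> #|A| = k by rewrite !inE => /andP[/andP[/eqP]].
have [cl clP] : exists cl : {set X} -> {set {set X}}, forall U,
    [/\ cl U \subset fam U, clean N k (cl U) & #|fam U :\: cl U| <= N * M].
  apply: (fin_all_exists (P := fun U (A : {set {set X}}) => [/\ A \subset fam U,
    clean N k A & #|fam U :\: A| <= N * M])) => U.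
  have [A sA [clA le]] := @cleaning N k X (fam U) (unifam U).
  exists A; split=> //; rewrite cardsDS // leq_subLR; apply: leq_trans le _.
  by rewrite leq_add2l leq_mul2l card_shadow ?orbT //; apply: unifam.
have famW U A : A \in fam U -> [disjoint A & W] by rewrite !inE => /andP[/andP[]].
have famF U A c : A \in fam U -> c \in U -> c |: A \in F.
  by rewrite !inE => /andP[_ /subsetP sub] /sub; rewrite inE => /andP[].
pose Pt j := [set U : {set X} | (U \subset W) && (#|U| == j)].
have cPt j : #|Pt j| <= 2 ^ w0.
  apply: (@leq_trans #|powerset W|); last by rewrite card_powerset leq_exp2l.
  by apply: subset_leq_card; apply/subsetP => U; rewrite !inE => /andP[].
(* Otherwise the traces embed in [fam U], and [U] has room for all [t.+1] points of [S]. *)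
have big_fam U : U \in Pt t.+1 -> #|fam U| <= N * M.
  rewrite inE => /andP[UW /eqP cU]; rewrite leqNgt; apply/negP => lt.
  have [us sH _] := treeH.
  have rH : rev s =i H by move=> E; rewrite mem_rev sH.
  have sz : size s = #|H| by rewrite -(card_uniqP us) (eq_card sH).
  have [|||f embf] := @tree_turan k V X (fam U) [seq E :\: S | E <- rev s] k0 (unifam U)
    (tree_seq_trace S (tree_ordering_seq treeH)).
  - by rewrite -size_eq0 size_map size_rev sz cards_eq0.
  - move=> _ /mapP[E + ->]; rewrite rH; exact: card_trace unifH cutS.
  - apply: leq_ltn_trans lt; rewrite size_map size_rev sz.
    apply: leq_mul; last exact: card_shadow (unifam U).
    by rewrite leq_mul2l ltnS (leqW (leqnSn _)) orbT.
  case/negP: noH; apply: (trace_embedding unifH cutS (tree_ordering_seq treeH) rH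
    (U := U) (A := fam U)) embf => //.
  - by rewrite cU cardS.
  - move=> B /famW; exact: disjointWr.
  - by move=> B c; apply: famF.
pose L := #|[set A in Om | #|nb A| < t]|; pose G := #|[set A in Om | t < #|nb A|]|.
have leG : G <= 2 ^ w0 * N * M.
  have sub : [set A in Om | t < #|nb A|] \subset \bigcup_(U in Pt t.+1) fam U.
    apply/subsetP => A; rewrite inE => /andP[AO tA].
    have [|U [_ sU cU]] := @subset_between _ set0 (nb A) t.+1 (sub0set _).
      by rewrite cards0.
    apply/bigcupP; exists U; last by rewrite inE AO.
    rewrite inE cU eqxx andbT; apply: subset_trans sU _.
    by apply/subsetP => c; rewrite inE => /andP[].
  apply: leq_trans (subset_leq_card sub) _; apply: leq_trans (card_bigcup_le _ _) _.
  apply: leq_trans (leq_sum _ big_fam) _; rewrite sum_nat_const -mulnA.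
  by rewrite leq_mul2r cPt orbT.
(* The edges are sorted by their intersection with [W]: empty, at least two points, exactly one
   point. *)
have leFW : #|F| <= #|F0| + w0 * w0 * M + \sum_(A in Om) #|nb A|.
  pose P2 := [set p in setX W W | p.1 != p.2].
  pose F2 := \bigcup_(p in P2) [set D : {set X} | (#|D| == k.+1) && ([set p.1; p.2] \subset D)].
  pose F1 := \bigcup_(A in Om) [set c |: A | c in nb A].
  have sub : F \subset F0 :|: F2 :|: F1.
    apply/subsetP => D DF; have cD := eqP (forall_inP unifF D DF).
    rewrite !in_setU; have [dis|] := boolP [disjoint D & W]; first by rewrite inE DF dis.
    rewrite -setI_eq0 => /set0Pn[c /setIP[cD' cW']]; apply/orP.
    have [/exists_inP[c' c'DW ne]|] := boolP [exists c' in D :&: W, c' != c].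
      left; apply/orP; right; apply/bigcupP; exists (c, c').
        by case/setIP: c'DW => _ c'W; rewrite !inE cW' c'W eq_sym.
      by case/setIP: c'DW => c'D _; rewrite inE cD eqxx subUset !sub1set cD' c'D.
    rewrite negb_exists_in => /forall_inP only; right; apply/bigcupP; exists (D :\ c).
      rewrite inE; apply/andP; split; first by move: cD; rewrite (cardsD1 c) cD' add1n => -[->].
      rewrite -setI_eq0; apply/eqP/setP => x; rewrite !inE; apply/negP => /andP[/andP[xc xD] xW].
      by have := only x; rewrite inE xD xW xc => /(_ isT).
    by apply/imsetP; exists c; rewrite ?setD1K // inE cW' setD1K.
  apply: leq_trans (subset_leq_card sub) _; rewrite cardsU; apply: leq_trans (leq_subr _ _) _.
  apply: leq_add; last first.
    apply: leq_trans (card_bigcup_le _ _) _; apply: leq_sum => A _; exact: leq_imset_card.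
  rewrite cardsU; apply: leq_trans (leq_subr _ _) _; rewrite leq_add2l.
  apply: leq_trans (card_bigcup_le _ _) _; apply: (@leq_trans (\sum_(p in P2) M)).
    apply: leq_sum => -[c c']; rewrite !inE /= => /andP[_ ne].
    by apply: leq_trans (card_supersets _ _) _; rewrite cards2 ne subSS.
  rewrite sum_nat_const leq_mul2r; apply/orP; right.
  apply: leq_trans (leq_mul cW cW); rewrite -cardsX; apply: subset_leq_card.
  by apply/subsetP => p; rewrite inE => /andP[].
have leOm : L + \sum_(A in Om) #|nb A| <= t * #|Om| + w0 * G.
  (* Pointwise, [d < t] + d <= t + w0 * [d > t] for d = #|nb A| <= w0. *)
  rewrite /L /G !card_set_sum mulnC -sum_nat_const big_distrr /= -!big_split /=.
  apply: leq_sum => A _; have : #|nb A| <= w0.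
    apply: leq_trans cW; apply: subset_leq_card.
    by apply/subsetP => c; rewrite inE => /andP[].
  move: #|nb A| => x xw; case: (ltngtP x t) => xt; rewrite ?muln1 ?muln0 ?addn0 ?add0n ?add1n ?xt //.
  by apply: leq_trans xw (leq_addl _ _).
have cOm : #|Om| <= 'C(n - t, k) + t * M.
  apply: leq_trans (bin_sub_le k nt); rewrite -[leqRHS]/('C(#|X|, k)) -card_draws.
  by apply: subset_leq_card; apply/subsetP => A; rewrite !inE => /andP[].
(* The assumed size of [F] is at least [t * 'C(n - t, k)], hence nearly [t * #|Om|]; each deficient
   set must be made up for by [F0] or by terms of order [M]. *)
have leL : L <= #|F0| + (t * t + w0 * w0) * M + w0 * (2 ^ w0 * N) * M.
  have := bin_sub_ge k nt; have : t * #|Om| <= t * 'C(n - t, k) + t * t * M.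
    by rewrite -mulnA -mulnDr leq_mul2l cOm orbT.
  have : w0 * G <= w0 * (2 ^ w0 * N) * M by rewrite -mulnA leq_mul2l leG orbT.
  move: leF leFW leOm; rewrite -/n mulnDl.
  move: (t * 'C(_, k)) ('C(n, _) - _) (\sum_(A in _) _) (t * #|_|) (w0 * G) L #|F| #|F0| (t * t * M) (w0 * w0 * M) (_ * M).
  clear; lia.
pose Cov := \bigcup_(U in Pt t) cl U.
pose Unc := [set A : {set X} | (#|A| == k) && (A \notin Cov)].
(* An uncovered set meets [W], has fewer than $t$ neighbours, or was lost in cleaning. *)
have leUnc : #|Unc| <= w0 * M + L + 2 ^ w0 * N * M.
  pose Um := \bigcup_(c in W) [set A : {set X} | (#|A| == k) && ([set c] \subset A)].
  pose Uc := \bigcup_(U in Pt t) (fam U :\: cl U).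
  have sub : Unc \subset Um :|: [set A in Om | #|nb A| < t] :|: Uc.
    apply/subsetP => A; rewrite inE => /andP[cA Acov]; rewrite !in_setU.
    have [AO|AO] := boolP (A \in Om); last first.
      have : ~~ [disjoint A & W] by move: AO; rewrite inE cA.
      rewrite -setI_eq0 => /set0Pn[c /setIP[cA' cW']].
      apply/orP; left; apply/orP; left; apply/bigcupP; exists c => //.
      by rewrite inE cA sub1set.
    have [lt|ge] := ltnP #|nb A| t; first by rewrite [in X in _ || X || _]inE AO lt orbT.
    apply/orP; right.
    have [|U [_ sU cU]] := @subset_between _ set0 (nb A) t (sub0set _).
      by rewrite cards0.
    have UP : U \in Pt t.
      rewrite inE cU eqxx andbT; apply: subset_trans sU _.
      by apply/subsetP => c; rewrite inE => /andP[].
    apply/bigcupP; exists U => //; rewrite inE [A \in fam U]inE AO sU /= andbT.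
    by apply: contra Acov => Acl; apply/bigcupP; exists U.
  apply: leq_trans (subset_leq_card sub) _; rewrite cardsU; apply: leq_trans (leq_subr _ _) _.
  apply: leq_add.
    rewrite cardsU; apply: leq_trans (leq_subr _ _) _; rewrite leq_add2r.
    apply: leq_trans (card_bigcup_le _ _) _; apply: (@leq_trans (\sum_(c in W) M)).
      apply: leq_sum => c _; apply: leq_trans (card_supersets _ _) _; by rewrite cards1.
    by rewrite sum_nat_const leq_mul2r cW orbT.
  apply: leq_trans (card_bigcup_le _ _) _; apply: (@leq_trans (\sum_(U in Pt t) N * M)).
    by apply: leq_sum => U _; case: (clP U).
  by rewrite sum_nat_const -mulnA leq_mul2r cPt orbT.
pose UT := [set a : {ffun 'I_k -> X} | a @: [set: 'I_k] \notin Cov].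
have leUT : #|UT| <= k * k * M + #|Unc| * k ^ k.
  have sub : UT \subset [set a : {ffun 'I_k -> X} | ~~ injectiveb a] :|:
      [set a : {ffun 'I_k -> X} | a @: [set: 'I_k] \in Unc].
    apply/subsetP => a; rewrite inE => aC; rewrite !inE aC andbT.
    case: injectiveP => //= inj; by rewrite card_imset // cardsT card_ord.
  apply: leq_trans (subset_leq_card sub) _; rewrite cardsU; apply: leq_trans (leq_subr _ _) _.
  apply: leq_add; first exact: card_noninjective.
  by apply: card_tuples_image => D; rewrite inE => /andP[/eqP->].
have zUT : z * #|UT| <= n ^ k.
  have : 2 * z * #|UT| <= 2 * z * C0 * M + 2 * z * k ^ k * #|F0|.
    rewrite -(mulnA (2 * z) C0) -(mulnA (2 * z) (k ^ k)) -mulnDr leq_mul2l; apply/orP; right.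
    apply: leq_trans leUT _; rewrite /C0 mulnDl -addnA leq_add2l.
    rewrite (mulnC #|Unc|) -mulnA -mulnDr leq_mul2l; apply/orP; right.
    apply: leq_trans leUnc _; rewrite !mulnDl; move: leL; rewrite !mulnDl.
    move: (2 ^ w0 * N * M) (w0 * (2 ^ w0 * N) * M) (w0 * M) (t * t * M) (w0 * w0 * M) (L) #|F0|; clear. lia.
  have : 2 * z * C0 * M <= n ^ k by rewrite nk leq_mul2r nC orbT.
  rewrite -(mulnA 2 z #|UT|); move: leF0.
  move: (2 * z * C0 * M) (2 * z * k ^ k * #|F0|) (z * #|UT|) (n ^ k); clear; lia.
have nk0 : 0 < n ^ k by rewrite expn_gt0 n_gt0.
have ltUT : k.+1 * #|UT| < n ^ k.
  have [U0|Upos] := posnP #|UT|; first by rewrite U0 muln0.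
  apply: leq_trans zUT; rewrite ltn_pmul2r // /z; clear; nia.
have [a leBad] := hybrid_good UT n_gt0; set Bad := [set a' | _] in leBad.
have notBad a' : a' \notin Bad -> forall j, j <= k -> hybrid j a a' @: [set: 'I_k] \in Cov.
  rewrite inE negb_exists => /forallP h j jk.
  by have := h (Ordinal (jk : j < k.+1)); rewrite inE negbK.
have covk A : A \in Cov -> #|A| = k.
  by case/bigcupP => U _ AU; case: (clP U) => _ [-> //].
have [a1 _ a1B] : exists2 a1, a1 \in [set: {ffun 'I_k -> X}] & a1 \notin Bad.
  apply: exists_notin; rewrite cardsT card_ffun card_ord; exact: leq_ltn_trans ltUT.
have hyb0 a' : hybrid 0 a a' = a by apply/ffunP => i; rewrite ffunE.
have hybk a' : hybrid k a a' = a' by apply/ffunP => i; rewrite ffunE ltn_ord.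
have := notBad a1 a1B 0 isT; rewrite hyb0 => /bigcupP[T TP aT].
have [TW cT] : T \subset W /\ #|T| = t by move: TP; rewrite inE => /andP[? /eqP].
have goodT a' : a' \notin Bad -> a' @: [set: 'I_k] \in cl T.
  move=> a'B; suff hyb j : j <= k -> hybrid j a a' @: [set: 'I_k] \in cl T.
    by rewrite -(hybk a') hyb.
  (* Consecutive hybrids differ in one coordinate and so share at least $k-1\ge 2$ vertices;
     [no_common_pair] excludes a change of [T]. *)
  elim: j => [|j IH] jk; first by rewrite hyb0.
  have Aj := IH (ltnW jk).
  have Aj1 := notBad a' a'B _ jk.
  case/bigcupP: (Aj1) => T' T'P AT'.
  have [-> //|ne] := eqVneq T T'.
  have [T'W cT'] : T' \subset W /\ #|T'| = t by move: T'P; rewrite inE => /andP[? /eqP].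
  have [sT clT _] := clP T; have [sT' clT' _] := clP T'.
  case/negP: noH; apply: (no_common_pair nV TW T'W cT cT' ne clT clT' _ _ _ _ Aj AT').
  - by move=> C /(subsetP sT)/famW.
  - by move=> C /(subsetP sT')/famW.
  - by move=> C c /(subsetP sT); apply: famF.
  - by move=> C c /(subsetP sT'); apply: famF.
  have injj : injective (hybrid j a a').
    move=> x y; apply: (imset_injP _ _ _); rewrite ?inE //.
    by rewrite (covk _ (subsetP _ _ Aj)) ?cardsT ?card_ord //; apply: bigcup_sup TP.
  pose R := ~: [set Ordinal jk].
  have cR : 2 <= #|R| by rewrite cardsC1 card_ord; move: k3; clear; lia.
  apply: leq_trans cR _; rewrite -(card_imset R injj); apply: subset_leq_card.
  apply/subsetP => _ /imsetP[i iR ->]; rewrite inE imset_f ?inE //=.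
  suff -> : hybrid j a a' i = hybrid j.+1 a a' i by rewrite imset_f ?inE.
  have ij : i != j :> nat by apply: contraTneq iR => ij; rewrite !inE negbK; apply/eqP/val_inj.
  by rewrite !ffunE [i < j.+1]ltnS [i <= j]leq_eqVlt (negPf ij).
exists T => //; set Mi := [set D | _].
pose NC := [set A : {set X} | (#|A| == k) && (A \notin cl T)].
have leMi : #|Mi| <= t * #|NC|.
  have sub : Mi \subset \bigcup_(c in T) [set c |: A | A in NC].
    apply/subsetP => D; rewrite inE => /and3P[/eqP cD]; rewrite -setI_eq0.
    case/set0Pn => c /setIP[cD' cT'] DF; apply/bigcupP; exists c => //.
    apply/imsetP; exists (D :\ c); last by rewrite setD1K.
    rewrite inE; apply/andP; split; first by move: cD; rewrite (cardsD1 c) cD' add1n => -[->].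
    apply: contra DF => Dcl; rewrite -(setD1K cD'); apply: (famF T) => //.
    by case: (clP T) => /subsetP sT _ _; apply: sT.
  apply: leq_trans (subset_leq_card sub) _; apply: leq_trans (card_bigcup_le _ _) _.
  apply: (@leq_trans (\sum_(c in T) #|NC|)); last by rewrite sum_nat_const cT.
  apply: leq_sum => c _; exact: leq_imset_card.
have leNC : #|NC| <= #|Bad|.
  apply: leq_trans (card_uniform_tuples k0 _) _; first by move=> D; rewrite inE => /andP[/eqP].
  apply: subset_leq_card; apply/subsetP => a'; rewrite 2!inE => /andP[_ /andP[_]].
  by apply: contraNT; apply: goodT.
apply: leq_trans zUT; apply: (@leq_trans (e * (t * (k.+1 * #|UT|)))).
  rewrite leq_mul2l; apply/orP; right; apply: leq_trans leMi _.
  by rewrite leq_mul2l (leq_trans leNC leBad) orbT.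
rewrite !mulnA leq_mul2r; apply/orP; right; rewrite /z; clear; nia.
Qed.

End Stability.

(** * Sparsely damaged sets *)

Lemma double_count (Q Y : finType) (P : {set Q}) (Ms : {set Y}) (R : Q -> pred Y)
    lo c m :
  (forall p, p \in P -> lo <= c * #|[set A in Ms | R p A]|) ->
  (forall A, A \in Ms -> #|[set p in P | R p A]| <= m) ->
  #|P| * lo <= c * (m * #|Ms|).
Proof.
move=> Plo Mm; rewrite -sum_nat_const.
apply: (@leq_trans (\sum_(p in P) c * #|[set A in Ms | R p A]|)); first exact: leq_sum.
rewrite -big_distrr leq_mul2l; apply/orP; right.
rewrite (eq_bigr (fun p => \sum_(A in Ms) R p A)) => [|p _]; last exact: card_set_sum.
rewrite exchange_big /= mulnC -sum_nat_const; apply: leq_sum => A AM.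
by rewrite -card_set_sum; apply: Mm.
Qed.

Section Sparse.

Variables (k t N : nat) (X : finType) (T : {set X}) (Ms : {set {set X}}).
Hypothesis k0 : 0 < k.
Hypothesis cT : #|T| = t.
Hypothesis Msk : forall A, A \in Ms -> #|A| = k.

Let n := #|X|.

Implicit Types Y Z : {set X}.

(* The ratio 4 k 2^k between consecutive values makes at most n / 4 points b
   spoil a set with no overfull subset; the last value is 2 so that a member of
   Ms is itself overfull. *)
Definition theta (k j : nat) : nat := (4 * k * 2 ^ k) ^ (k - j) * 2.

(** $n^{k-|Z|}$ is the trivial bound for the number of $k$-sets containing [Z], so this is a density
    above [1 / theta] with the denominator cleared. *)
Definition overfull (Z : {set X}) : bool :=
  n ^ (k - #|Z|) < theta k #|Z| * #|[set A in Ms | Z \subset A]|.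

Definition sparse (Z : {set X}) : bool :=
  [disjoint Z & T] && [forall Y : {set X}, (Y \subset Z) ==> ~~ overfull Y].

Lemma sparseP Z : reflect ([disjoint Z & T] /\ forall Y, Y \subset Z -> ~~ overfull Y)
  (sparse Z).
Proof.
apply: (iffP andP) => [[d /forallP h]|[d h]]; split=> //.
  by move=> Y; apply: implyP (h Y).
by apply/forallP => Y; apply/implyP/h.
Qed.

Lemma sparseS Z Z' : Z' \subset Z -> sparse Z -> sparse Z'.
Proof.
move=> sub /sparseP[d h]; apply/sparseP; split; first exact: disjointWl sub d.
by move=> Y sY; apply: h; apply: subset_trans sub.
Qed.

(** Counting incidences between such points [b] and the members of [Ms] containing [b |: Y]: too
    many [b] would make [Y] itself overfull. *)
Lemma card_overfull_ext Y : #|Y| < k -> ~~ overfull Y ->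
  4 * k * 2 ^ k * #|[set b | (b \notin Y) && overfull (b |: Y)]| <= k * n.
Proof.
move=> Yk; rewrite /overfull -leqNgt => leY; set B := [set b | _].
have [n0|n0] := posnP n; first by rewrite (_ : #|B| = 0) ?muln0 //;
  apply/eqP; rewrite -leqn0 -n0 max_card.
pose E := n ^ (k - #|Y|.+1); have E0 : 0 < E by rewrite expn_gt0 n0.
have nE : n ^ (k - #|Y|) = n * E by rewrite /E -expnS -subSn.
have th : theta k #|Y| = 4 * k * 2 ^ k * theta k #|Y|.+1.
  by rewrite /theta mulnA -expnS -subSn.
have := @double_count X {set X} B [set A in Ms | Y \subset A] (fun b A => b |: Y \subset A)
   E (theta k #|Y|.+1) k.
have h1 p : p \in B -> E <= theta k #|Y|.+1 *
    #|[set A in [set A in Ms | Y \subset A] | p |: Y \subset A]|.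
  rewrite inE /overfull => /andP[pY]; rewrite cardsU1 pY add1n => /ltnW le.
  apply: leq_trans le _; rewrite leq_mul2l; apply/orP; right; apply: subset_leq_card.
  apply/subsetP => A; rewrite !inE => /andP[AM sA]; rewrite AM sA (subset_trans _ sA) //.
  exact: subsetUr.
have h2 A : A \in [set A in Ms | Y \subset A] -> #|[set p in B | p |: Y \subset A]| <= k.
  rewrite inE => /andP[/Msk <- _]; apply: subset_leq_card; apply/subsetP => b.
  by rewrite inE subUset sub1set => /and3P[].
move=> /(_ h1 h2) le; rewrite -(leq_pmul2r E0).
apply: (@leq_trans (4 * k * 2 ^ k * (theta k #|Y|.+1 * (k * #|[set A in Ms | Y \subset A]|)))).
  by rewrite -mulnA leq_mul2l le orbT.
by rewrite mulnA -th mulnCA -mulnA leq_mul2l -nE leY orbT.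
Qed.

Hypothesis n_large : 2 * (t + k + N).+1 <= n.

(** A point outside [T] and [Z] fails only if it makes [b |: Y] overfull for some subset [Y] of [Z].
    Over all [Y] this excludes at most a quarter of the vertices. *)
Lemma sparse_ext Z : sparse Z -> #|Z| < k ->
  N < #|[set b | (b \notin Z) && sparse (b |: Z)]|.
Proof.
move=> spZ Zk; have [dZ ovZ] := sparseP _ spZ; set G := [set b | _].
pose bad (Y : {set X}) := [set b | (b \notin Y) && overfull (b |: Y)].
pose Bad := \bigcup_(Y in powerset Z) bad Y.
have cBad : 4 * #|Bad| <= n.
  have c0 : 0 < k * 2 ^ k by rewrite muln_gt0 k0 expn_gt0.
  rewrite -(leq_pmul2r c0).
  have le : #|Bad| <= \sum_(Y in powerset Z) #|bad Y| by apply: card_bigcup_le.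
  apply: (@leq_trans (\sum_(Y in powerset Z) k * n)).
    apply: (@leq_trans (\sum_(Y in powerset Z) 4 * k * 2 ^ k * #|bad Y|)).
      by rewrite -big_distrr /= mulnAC mulnA leq_mul2l le orbT.
    apply: leq_sum => Y; rewrite inE => YZ; apply: card_overfull_ext; last exact: ovZ.
    by apply: leq_ltn_trans (subset_leq_card YZ) Zk.
  rewrite sum_nat_const card_powerset [k * n]mulnC mulnCA leq_mul2l; apply/orP; right.
  by rewrite mulnC leq_mul2l leq_exp2l // (ltnW Zk) orbT.
have sub : [set: X] \subset G :|: (T :|: Z :|: Bad).
  apply/subsetP => b _; rewrite !in_setU; have [//|bG] := boolP (b \in G).
  have [//|bT] := boolP (b \in T); have [//|bZ] := boolP (b \in Z); rewrite /=.
  apply: contraNT bG => bBad; rewrite inE bZ /=; apply/sparseP; split.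
    rewrite -setI_eq0 setIUl setU_eq0 !setI_eq0 dZ andbT.
    by rewrite disjoints1.
  move=> Y sY; have [bY|bY] := boolP (b \in Y).
    have sYZ : Y :\ b \subset Z.
      by apply/subsetP => x; rewrite !inE => /andP[xb /(subsetP sY)]; rewrite !inE (negPf xb).
    apply: contra bBad => ov; apply/bigcupP; exists (Y :\ b); first by rewrite inE.
    by rewrite !inE eqxx setD1K.
  apply: ovZ; apply/subsetP => x xY; have := subsetP sY x xY; rewrite !inE.
  by case: eqP => // e; rewrite -e xY in bY.
have : n <= #|G| + (#|T| + #|Z| + #|Bad|).
  rewrite /n -cardsT; apply: leq_trans (subset_leq_card sub) _.
  rewrite cardsU; apply: leq_trans (leq_subr _ _) _; rewrite leq_add2l.
  rewrite cardsU; apply: leq_trans (leq_subr _ _) _; rewrite leq_add2r.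
  by rewrite cardsU leq_subr.
move: n_large cBad Zk; rewrite cT; move: n #|Z| #|Bad| #|G| => x1 x2 x3 x4; clear; lia.
Qed.

Definition sparse_sets : {set {set X}} :=
  [set A : {set X} | (#|A| == k) && sparse A].

Lemma sparse_clean : clean N k sparse_sets.
Proof.
split=> [E|E a]; first by rewrite inE => /andP[/eqP].
rewrite inE => /andP[/eqP cE spE] aE.
have cZ : #|E :\ a|.+1 = k by rewrite -cE (cardsD1 a E) aE.
have lt := @sparse_ext (E :\ a) (sparseS (subsetDl _ _) spE) (eq_leq cZ).
apply: leq_trans lt _; apply: subset_leq_card.
apply/subsetP => b; rewrite !inE => /andP[bZ spb].
rewrite spb andbT cardsU1 !inE bZ add1n cZ //.
Qed.

Lemma sparse_sub_sets Z : sparse Z -> #|Z| <= k ->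
  exists2 A, A \in sparse_sets & Z \subset A.
Proof.
elim: {Z}(k - #|Z|) {-2}Z (erefl (k - #|Z|)) => [|j IH] Z e spZ Zk.
  exists Z => //; rewrite inE spZ andbT; move: e Zk; move: #|Z| => x; clear; lia.
have Zk' : #|Z| < k by move: e; move: #|Z| => x; clear; lia.
have /card_gt0P[b] := leq_ltn_trans (leq0n N) (sparse_ext spZ Zk').
rewrite inE => /andP[bZ spb].
have cb : #|b |: Z| = #|Z|.+1 by rewrite cardsU1 bZ.
have [||A AS sA] := IH (b |: Z) _ spb; rewrite ?cb //.
  by move: e; move: #|Z| => x; clear; lia.
by exists A => //; apply: subset_trans sA; apply: subsetUr.
Qed.

Lemma sparse_sets_notin A : A \in sparse_sets -> A \notin Ms.
Proof.
rewrite inE => /andP[/eqP cA /sparseP[_ /(_ A (subxx _))]]; apply: contra => AM.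
rewrite /overfull cA subnn expn0 /theta subnn expn0 mul1n.
have : 0 < #|[set A0 in Ms | A \subset A0]|.
  by apply/card_gt0P; exists A; rewrite inE AM subxx.
by move: #|_| => x; clear; lia.
Qed.

Definition dense_pairs : {set {set X}} :=
  [set P : {set X} | [&& #|P| == 2, [disjoint P & T] & ~~ sparse P]].

(** Since the empty set is not overfull, a dense pair contains an overfull vertex or is overfull
    itself. There are $O(|Ms|/n^{k-1})$ overfull vertices, each in at most $n$ pairs, and
    $O(|Ms|/n^{k-2})$ overfull pairs. *)
Lemma card_dense_pairs : 2 <= k -> ~~ overfull set0 ->
  #|dense_pairs| * n ^ (k - 2) <= (theta k 1 * k + theta k 2 * 2 ^ k) * #|Ms|.
Proof.
move=> k2 ov0; pose B1 := [set u | overfull [set u]].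
pose G2 := [set P : {set X} | (#|P| == 2) && overfull P].
have n1 : n ^ (k - 1) = n * n ^ (k - 2).
  by rewrite -expnS; congr (_ ^ _); move: k2; clear; lia.
have c1 : #|B1| * n ^ (k - 1) <= theta k 1 * (k * #|Ms|).
  apply: (@double_count X {set X} B1 Ms (fun u A => [set u] \subset A)).
    by move=> u; rewrite inE /overfull cards1 => /ltnW.
  move=> A /Msk <-; apply: subset_leq_card; apply/subsetP => u.
  by rewrite inE sub1set => /andP[].
have c2 : #|G2| * n ^ (k - 2) <= theta k 2 * (2 ^ k * #|Ms|).
  apply: (@double_count {set X} {set X} G2 Ms (fun P A => P \subset A)).
    by move=> P; rewrite inE /overfull => /andP[/eqP->] /ltnW.
  move=> A /Msk <-; rewrite -card_powerset; apply: subset_leq_card; apply/subsetP => P.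
  by rewrite !inE => /andP[].
have sub : dense_pairs \subset [set [set p.1; p.2] | p in setX B1 [set: X]] :|: G2.
  apply/subsetP => P; rewrite inE => /and3P[/eqP cP dP spP]; rewrite in_setU.
  have [ovP|novP] := boolP (overfull P); first by rewrite !inE cP ovP orbT.
  move: spP; rewrite negb_and dP /= => /forallPn[Y]; rewrite negb_imply negbK => /andP[YP ovY].
  have cY : #|Y| = 1.
    have : #|Y| <= 2 by rewrite -cP subset_leq_card.
    have : #|Y| != 0 by apply: contraNneq ov0 => /eqP; rewrite cards_eq0 => /eqP <-.
    have : #|Y| != 2.
      apply: contraNneq novP => cY; suff -> : P = Y by [].
      by apply/eqP; rewrite eq_sym eqEcard YP cP cY.
    by move: #|Y| => x; clear; lia.
  move/eqP/cards1P: cY => [u eY]; have uP : u \in P by rewrite eY sub1set in YP.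
  have [v _ eP] := pair_with cP uP; apply/orP; left; apply/imsetP; exists (u, v) => //.
  by rewrite !inE -eY ovY.
have : #|dense_pairs| <= #|B1| * n + #|G2|.
  apply: leq_trans (subset_leq_card sub) _; rewrite cardsU; apply: leq_trans (leq_subr _ _) _.
  rewrite leq_add2r; apply: leq_trans (leq_imset_card _ _) _.
  by rewrite cardsX cardsT.
move=> le; apply: (@leq_trans ((#|B1| * n + #|G2|) * n ^ (k - 2))).
  by rewrite leq_mul2r le orbT.
rewrite !mulnDl -(mulnA #|B1|) -n1; apply: leq_add.
  by rewrite -(mulnA _ k).
by rewrite -(mulnA _ (2 ^ k)).
Qed.

End Sparse.

(** * Counting the remaining edges *)

Section Triangles.

Variables (X : finType) (G : {set {set X}}).

Let n := #|X|.

Definition triangles : {set X * X * X} :=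
  [set p | [&& p.1 \in adj_pairs G, (p.1.2, p.2) \in adj_pairs G &
            (p.1.1, p.2) \in adj_pairs G]].

(* Split according to whether the first vertex has degree at most n / d. *)
Lemma card_triangles d : 0 < n ->
  d * n * #|triangles| <=
  #|adj_pairs G| * n * n + d * d * #|adj_pairs G| * #|adj_pairs G|.
Proof.
move=> n0; have leC := card_cherries G n d; set Ch := [set p | _] in leC.
have leH := card_adj_high G d n0; set W := [set a | _] in leH.
set a := #|adj_pairs G| in leC leH *.
pose Hi := [set p : X * X * X | (p.1.1 \in W) && ((p.1.2, p.2) \in adj_pairs G)].
have cHi : #|Hi| <= #|W| * a.
  rewrite /a -cardsX -(card_imset Hi (f := fun p => (p.1.1, (p.1.2, p.2)))); last first.
    by move=> [[x y] u] [[x' y'] u'] /= [-> -> ->].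
  apply: subset_leq_card; apply/subsetP => _ /imsetP[p pH ->].
  by move: pH; rewrite inE => /andP[h1 h2]; rewrite in_setX /= h1.
have sub : triangles \subset Ch :|: Hi.
  apply/subsetP => p; rewrite inE => /and3P[h1 h2 h3]; rewrite in_setU.
  have [h|h] := boolP (p.1.1 \in W).
    by apply/orP; right; rewrite inE h h2.
  by apply/orP; left; rewrite inE h1 h3 !andbT leqNgt; rewrite inE in h.
have : #|triangles| <= #|Ch| + #|W| * a.
  apply: leq_trans (subset_leq_card sub) _; rewrite cardsU.
  by apply: leq_trans (leq_subr _ _) _; rewrite leq_add2l.
move=> le; apply: (@leq_trans (d * n * (#|Ch| + #|W| * a))).
  by rewrite leq_mul2l le orbT.
rewrite mulnDr; apply: leq_add.
  by rewrite mulnAC leq_mul2r (mulnC d) leC orbT.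
have -> : d * n * (#|W| * a) = d * (#|W| * n) * a.
  by rewrite !mulnA -!(mulnA d) (mulnC n).
have -> : d * d * a * a = d * (d * a) * a by rewrite !mulnA.
by rewrite leq_mul2r leq_mul2l leH !orbT.
Qed.

(** In a tuple listing a shadow set, the first three coordinates form a triangle of [G], and the
    other $k-3$ are free. *)
Lemma card_shadow_triangles k (DD : {set {set X}}) : 3 <= k ->
  (forall D, D \in DD -> #|D| = k.+1) ->
  (forall D u v, D \in DD -> u \in D -> v \in D -> u != v -> [set u; v] \in G) ->
  #|shadow DD| <= #|triangles| * n ^ (k - 3).
Proof.
move=> k3 unif pairs; have k0 : 0 < k by apply: leq_trans k3.
have shP E : E \in shadow DD -> exists2 D, D \in DD & E \subset D /\ #|E| = k.
  case/bigcupP => D DD' /imsetP[a aD ->]; exists D => //; rewrite subsetDl; split=> //.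
  by have := unif D DD'; rewrite (cardsD1 a) aD add1n => -[].
apply: leq_trans (card_uniform_tuples k0 _) _.
  by move=> E /shP[D _ []].
pose o0 : 'I_k := Ordinal (leq_trans (isT : 0 < 3) k3).
pose o1 : 'I_k := Ordinal (leq_trans (isT : 1 < 3) k3).
pose o2 : 'I_k := Ordinal (leq_trans (isT : 2 < 3) k3).
have cA : #|~: [set o0; o1; o2]| = k - 3.
  have := cardsC [set o0; o1; o2]; rewrite setUC cardsU1 !inE cards2 card_ord /=.
  by move: (k3) #|~: _|; clear; lia.
rewrite -cA; apply: (@card_by_coords _ X _ (fun z => ((z o0, z o1), z o2))) => [z|y z].
  rewrite inE => /andP[/injectiveP inj /shP[D DD' [sub _]]].
  have adj i j : i != j -> (z i, z j) \in adj_pairs G.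
    move=> ij; rewrite inE /=; apply: (pairs D) => //.
    - by apply: (subsetP sub); rewrite imset_f.
    - by apply: (subsetP sub); rewrite imset_f.
    - by apply: contra ij => /eqP/inj->.
  by rewrite inE /= !adj.
by case=> e0 e1 e2 i; rewrite !inE -orbA => /or3P[] /eqP->.
Qed.

End Triangles.

Lemma turan_relabel r m (W X : finType) (G : {set {set W}}) (F : {set {set X}})
    (T : {set X}) :
  uniform r F -> ~~ contains G F -> (forall D, D \in F -> [disjoint D & T]) ->
  #|X| - #|T| = m -> #|F| <= ex_turan r m G.
Proof.
move=> unif noG FT cm; have cT : #|~: T| = m by rewrite -cm -(cardsC T) addKn.
pose e (i : 'I_m) : X := enum_val (cast_ord (esym cT) i).
have inje : injective e by move=> i j /enum_val_inj/cast_ord_inj.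
have eT x : x \notin T -> exists i, e i = x.
  move=> xT; have xT' : x \in ~: T by rewrite inE.
  exists (cast_ord cT (enum_rank_in xT' x)); rewrite /e cast_ordK enum_rankK_in //.
pose pre (D : {set X}) := e @^-1: D.
have preK D : D \in F -> e @: pre D = D.
  move=> DF; apply/setP => x; apply/imsetP/idP => [[i]|xD]; first by rewrite inE => iD ->.
  have [i ei] := eT x (negbT (disjointFr (FT D DF) xD)).
  by exists i; rewrite ?inE ei.
have injpre : {in F &, injective pre}.
  by move=> D D' DF DF' epre; rewrite -(preK D DF) -(preK D' DF') epre.
rewrite -(card_in_imset injpre); apply: (@leq_bigmax_cond _ _ _ (pre @: F)).
apply/andP; split.
  apply/forall_inP => _ /imsetP[D DF ->].
  by rewrite -(card_imset _ inje) preK // (forall_inP unif).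
apply: contra noG => /existsP[f /andP[/injectiveP injf /forall_inP emb]].
apply/existsP; exists (finfun (e \o f)); apply/andP; split.
  by apply/injectiveP => x y; rewrite !ffunE => /inje/injf.
apply/forall_inP => E /emb/imsetP[D DF eD].
rewrite (_ : _ @: E = D) // -(preK D DF) -eD -imset_comp.
by apply: eq_imset => x; rewrite ffunE.
Qed.

Lemma card_meeting (X : finType) (T : {set X}) r :
  #|[set D : {set X} | (#|D| == r) && ~~ [disjoint D & T]]| =
  'C(#|X|, r) - 'C(#|X| - #|T|, r).
Proof.
have := cardsID [set D : {set X} | [disjoint D & T]] [set D : {set X} | #|D| == r].
rewrite card_draws (_ : #|_ :&: _| = 'C(#|X| - #|T|, r)).
  by move=> <-; rewrite addKn; apply: eq_card => D; rewrite !inE andbC.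
rewrite -(cardsC T) addKn -cards_draws.
by apply: eq_card => D; rewrite !inE disjoints_subset andbC.
Qed.

Section StarEmbedding.

Variables (k p : nat) (V X : finType) (Hw : {set {set V}}) (w : V).
Variables (D0 At : {set V}) (F : {set {set X}}) (good : pred {set X}).
Hypotheses (k0 : 0 < k) (copy : is_copy (linear_star k.+1 p) Hw).
Hypotheses (D0w : D0 \in Hw) (HwP : forall D, D \in Hw -> w \in D).
Hypotheses (AtD : At \subset D0) (wAt : w \notin At) (cAt : #|At| <= 2).
Hypothesis single : Hw = [set D0] \/ #|At| <= 1.
Hypothesis goodF : forall D, D \in F -> exists P : {set X}, [/\ #|P| = 2, P \subset D & good P].

(* If the star has at least two edges, then w is its center and At has at most
   one element; one of the two points of P is not the image of the center, and
   permuting the vertices of the first edge sends At to it. *)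
Lemma star_embedding : contains (linear_star k.+1 p) F ->
  exists (h : V -> X) (P : {set X}), [/\ good P, {in cover Hw &, injective h},
    (forall E, E \in Hw -> h @: E \in F) & h @: At \subset P].
Proof.
case/existsP => h /andP[/injectiveP injh /forall_inP emb].
have starw := fun D D' v a b c d e f g => @linear_star_inter _ _ _ Hw D D' w v copy a b c d e f g.
case: copy => f0 injf0 eH.
pose edge (i : 'I_p) : {set option ('I_p * 'I_k)} := None |: [set Some (i, j) | j : 'I_k].
have Some_edge i i' j : (Some (i, j) \in edge i') = (i == i').
  rewrite !inE /=; apply/imsetP/eqP => [[j' _ [-> _]]//|->]; by exists j.
have edgeP D : D \in Hw -> exists i, D = f0 @: edge i.
  by rewrite eH => /imsetP[_ /imsetP[i _ ->] ->]; exists i.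
have embe i : h @: edge i \in F by apply: emb; apply/imsetP; exists i.
have edgeH i : f0 @: edge i \in Hw by rewrite eH; apply: imset_f; apply/imsetP; exists i.
have [i0 eD0] := edgeP D0 D0w.
have [P [cP sP gP]] := goodF (embe i0).
have cD0 : #|D0| = #|h @: edge i0| by rewrite eD0 !card_imset.
have [e1|ne] := eqVneq Hw [set D0].
  have [x0 x0P] : exists x0, x0 \in P by apply/card_gt0P; rewrite cP.
  have [||||phi [_ p2 p3]] := @ext_inj V X set0 At P (fun=> x0).
  - exact: sub0set.
  - by rewrite cP.
  - by move=> u v; rewrite inE.
  - by rewrite imset0 sub0set.
  have [|||g [g1 g2 g3]] := @ext_inj V X At D0 (h @: edge i0) phi AtD.
  - by rewrite cD0.
  - done.
  - exact: subset_trans p3 sP.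
  exists g, P; split=> //.
  - by rewrite e1 cover1.
  - by move=> E; rewrite e1 inE => /eqP->; rewrite (card_imset_in g2 g3).
  - by rewrite (eq_in_imset g1).
have At1 : #|At| <= 1 by case: (single) ne => // ->; rewrite eqxx.
have /subsetPn[D1 D1w D1D0] : ~~ (Hw \subset [set D0]).
  by apply: contra_neqN ne => sub; apply/eqP; rewrite eqEsubset sub sub1set.
rewrite inE in D1D0.
have [i1 eD1] := edgeP D1 D1w.
have Nonew : f0 None = w.
  apply: (starw D1 D0) => //; [exact: HwP|exact: HwP| |].
    by rewrite eD1 imset_f // !inE.
  by rewrite eD0 imset_f // !inE.
have [j0 AtP] : exists j0, At \subset [set f0 (Some (i0, j0))].
  have [->|/set0Pn[x xA]] := eqVneq At set0.
    by exists (Ordinal k0); rewrite sub0set.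
  have /imsetP[o oE ex] : x \in f0 @: edge i0 by rewrite -eD0 (subsetP AtD).
  case: o oE ex => [[i j]|] oE ex; last by move: (wAt); rewrite -Nonew -ex xA.
  rewrite Some_edge in oE; exists j; rewrite -(eqP oE) -ex.
  by apply/subsetP => y yA; rewrite inE (card_le1_eqP At1 x y xA yA).
have [y yP yN] : exists2 y, y \in P & y \notin [set h None].
  by apply: exists_notin; rewrite cards1 cP.
rewrite inE in yN.
have [j1 ey] : exists j1, y = h (Some (i0, j1)).
  have /imsetP[o oE ey] := subsetP sP y yP.
  case: o oE ey => [[i j]|] oE ey; last by rewrite ey eqxx in yN.
  by rewrite Some_edge in oE; exists j; rewrite -(eqP oE).
(* [sg] swaps two vertices of the edge [i0] other than the center, so it maps every edge of the star
   to itself; [g] inverts [f0]. *)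
pose sg := tperm (Some (i0, j0)) (Some (i0, j1)).
pose g x := odflt None [pick o | f0 o == x].
have gK o : g (f0 o) = o.
  rewrite /g; case: pickP => [o' /eqP/injf0->//|/(_ o)]; by rewrite eqxx.
pose hH x := h (sg (g x)).
have sgE i : sg @: edge i = edge i.
  apply/eqP; rewrite eqEcard (card_imset _ (@perm_inj _ sg)) leqnn andbT.
  apply/subsetP => _ /imsetP[o oE ->].
  by rewrite /sg; case: tpermP oE => [->|->|_ _]; rewrite ?Some_edge.
have hHE i : hH @: (f0 @: edge i) = h @: edge i.
  rewrite -[in RHS](sgE i) -!imset_comp; apply: eq_imset => o.
  by rewrite /hH /= gK.
exists hH, P; split=> //.
- move=> u v /coverP[E /edgeP[i ->] /imsetP[o _ ->]] /coverP[E' /edgeP[i' ->] /imsetP[o' _ ->]].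
  by rewrite /hH !gK => /injh/perm_inj->.
- by move=> E /edgeP[i ->]; rewrite hHE.
- apply/subsetP => _ /imsetP[x /(subsetP AtP)/set1P -> ->].
  by rewrite /hH gK /sg tpermL -ey.
Qed.

End StarEmbedding.

(** Here [a] counts ordered bad pairs, [tri] their triangles, [dd] the edges with bad pairs only,
    [M] the missing sets, and $nE=n^{k-2}$. Bad pairs number at most $cM/(nE)$, hence at most
    $cn^2/e$. In the triangle bound, [d] controls the first term and [e] the second. *)
Lemma final_arith (n E a tri dd M N c d e : nat) :
  0 < n -> 0 < E -> 2 * N * c < d -> d * d * c < e ->
  a * (n * E) <= c * M -> e * M <= n * n * n * E ->
  d * n * tri <= a * n * n + d * d * a * a -> dd <= N * (tri * E) -> dd <= M.
Proof.
move=> n0 E0 hd he h1 h2 h3 h4.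
have nE : 0 < n * E by rewrite muln_gt0 n0.
have e0 : 0 < e by apply: leq_ltn_trans he.
have d0 : 0 < d by apply: leq_ltn_trans hd.
have p1 : e * a <= c * (n * n).
  rewrite -(leq_pmul2r nE); apply: (@leq_trans (c * (e * M))).
    by rewrite -(mulnA e a) (mulnCA c e) leq_mul2l h1 orbT.
  by rewrite -(mulnA c (n * n)) leq_mul2l (mulnA (n * n)) h2 orbT.
have p2 : e * (d * n * dd) <= N * n * c * M * (e + d * d * c).
  apply: (@leq_trans (e * (N * (E * (a * n * n + d * d * a * a))))).
    rewrite leq_mul2l; apply/orP; right.
    apply: (@leq_trans (d * n * (N * (tri * E)))); first by rewrite leq_mul2l h4 orbT.
    rewrite mulnCA leq_mul2l; apply/orP; right.
    by rewrite mulnA mulnC leq_mul2l h3 orbT.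
  have -> : e * (N * (E * (a * n * n + d * d * a * a))) =
            N * (e * n * (a * (n * E)) + d * d * (E * a) * (e * a)).
    by clear; lia.
  have -> : N * n * c * M * (e + d * d * c) =
            N * (e * n * (c * M) + d * d * c * n * (c * M)).
    by clear; lia.
  rewrite leq_mul2l; apply/orP; right; apply: leq_add; first by rewrite leq_mul2l h1 orbT.
  apply: (@leq_trans (d * d * (E * a) * (c * (n * n)))); first by rewrite leq_mul2l p1 orbT.
  have -> : d * d * (E * a) * (c * (n * n)) = d * d * c * n * (a * (n * E)) by clear; lia.
  by rewrite leq_mul2l h1 orbT.
have p3 : e * n * (d * dd) <= e * n * (d * M).
  apply: (@leq_trans (N * n * c * M * (e + e))).
    have -> : e * n * (d * dd) = e * (d * n * dd) by clear; lia.
    by apply: leq_trans p2 _; rewrite leq_mul2l leq_add2l (ltnW he) orbT.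
  have -> : N * n * c * M * (e + e) = e * n * (2 * N * c * M) by clear; lia.
  by rewrite !leq_mul2l leq_mul2r (ltnW hd) !orbT.
by move: p3; rewrite leq_pmul2l ?muln_gt0 ?e0 // leq_pmul2l.
Qed.

(** * The upper bound for the Turán number *)

Section Final.

Variables (k t p : nat) (V : finType) (H : {set {set V}}) (S : {set V}) (w : V).
Variables (s q : seq {set V}) (D0 Ea : {set V}).
Hypotheses (k3 : 3 <= k) (unifH : uniform k.+1 H) (redH : reducible (k.+1 - 2) H).
Hypotheses (treeH : tree_ordering H s) (cutS : cross_cut H S) (wS : w \in S).
Hypotheses (cardS : #|S| = t.+1) (tq : tree_seq q) (size_q : size q <= #|H|).
Hypothesis qH : q =i [set E in H | w \notin E].
Hypotheses (D0w : D0 \in edges_at H w) (Eaq : Ea \in q).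
Hypothesis attach : forall v E D, E \in q -> D \in edges_at H w ->
  v \in E -> v \in D -> v \in D0 :&: Ea.
Hypothesis cardA : #|D0 :&: Ea| <= 2.
Hypothesis single : edges_at H w = [set D0] \/ #|D0 :&: Ea| <= 1.
Hypothesis copy : is_copy (linear_star k.+1 p) (edges_at H w).

(** [F] splits into the edges meeting [T], the family [DD] of edges avoiding [T] with dense pairs
    only, and the rest [F']. The star is not contained in [F'], and [DD] is no larger than the set
    [Mi] of missing sets. *)
Lemma turan_bound : exists n1 : nat, 0 < n1 /\
  forall n : nat, n1 <= n ->
    ex_turan k.+1 n H <=
      'C(n, k.+1) - 'C(n - t, k.+1) + ex_turan k.+1 (n - t) (linear_star k.+1 p).
Proof.
have k0 : 0 < k by apply: leq_trans k3.
have k2 : 2 <= k by apply: leq_trans k3.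
have inHw D : D \in edges_at H w -> D \in H /\ w \in D by rewrite inE => /andP.
have starw D D' v : D \in edges_at H w -> D' \in edges_at H w ->
    D != D' -> v \in D -> v \in D' -> v = w.
  move=> Dw Dw' ne vD vD'; have [_ wD] := inHw D Dw; have [_ wD'] := inHw D' Dw'.
  exact: (linear_star_inter copy Dw Dw' ne wD wD' vD vD').
pose N := #|V| * #|H|.+3.
(* [C1] comes from [card_dense_pairs] and the 4 from passing to ordered pairs. [d] and [e] are as
   [final_arith] asks, and [theta k 0] in [e] keeps the empty set from being overfull. *)
pose C1 := theta k 1 * k + theta k 2 * 2 ^ k; pose c := 4 * C1.
pose d := (2 * N * c).+1; pose e := (d * d * c + theta k 0).+1.
have [n0 stab] := stability k3 unifH redH treeH cutS wS cardS tq size_q qH D0w Eaq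
  attach cardA starw e.
exists (n0 + #|V| + 2 * (t + k + N).+1).+1; split=> // n nn1.
have [n_gt0 nn0 nV nlarge] : [/\ 0 < n, n0 <= n, #|V| <= n & 2 * (t + k + N).+1 <= n].
  by split; move: nn1; move: #|V| (2 * _); clear; lia.
apply/bigmax_leqP => F /andP[unifF noH].
have [small|big] := ltnP #|F| ('C(n, k.+1) - 'C(n - t, k.+1)).
  exact: leq_trans (ltnW small) (leq_addr _ _).
have cn := card_ord n.
have [T cT leMi] : exists2 T : {set 'I_n}, #|T| = t & e * #|[set D : {set 'I_n} |
    [&& #|D| == k.+1, ~~ [disjoint D & T] & D \notin F]]| <= n ^ k.
  by have := stab _ F; rewrite cn; apply.
set Mi := [set D | _] in leMi.
(* A $k$-set that avoids [T] and is not in [Ms] forms an edge of [F] with every point of [T], as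
   [attach_star] requires. *)
pose Ms := [set A : {set 'I_n} | [&& #|A| == k, [disjoint A & T] &
  ~~ [forall c in T, c |: A \in F]]].
have Msk A : A \in Ms -> #|A| = k by rewrite inE => /and3P[/eqP].
have leMs : #|Ms| <= #|Mi|.
  apply: leq_trans (leq_imset_card (fun D => D :\: T) Mi).
  apply: subset_leq_card; apply/subsetP => A; rewrite inE => /and3P[/eqP cA dA].
  case/forall_inPn => x xT xF; have xA : x \notin A by rewrite (disjointFl dA xT).
  apply/imsetP; exists (x |: A).
    rewrite inE xF cardsU1 xA cA eqxx andbT /= -setI_eq0; apply/set0Pn; exists x.
    by rewrite !inE eqxx.
  rewrite setDUl (setDidPl dA) (_ : [set x] :\: T = set0) ?set0U //.
  by apply/eqP; rewrite setD_eq0 sub1set.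
have ov0 : ~~ overfull k Ms set0.
  rewrite /overfull cards0 subn0 card_ord -leqNgt; apply: leq_trans leMi.
  apply: leq_mul; first by apply: leqW; apply: leq_addl.
  by apply: leq_trans leMs; apply: subset_leq_card; apply/subsetP => A; rewrite inE => /andP[].
pose G := dense_pairs k T Ms.
have G2 P : P \in G -> #|P| = 2 by rewrite inE => /and3P[/eqP].
have nlargeX : 2 * (t + k + N).+1 <= #|'I_n| by rewrite card_ord.
have cG := @card_dense_pairs k _ T Ms Msk k2 ov0.
rewrite -/G -/C1 card_ord in cG.
pose DD := [set D in F | [disjoint D & T] &&
  [forall u in D, forall v in D, (u != v) ==> ([set u; v] \in G)]].
pose F' := [set D in F | [disjoint D & T] && (D \notin DD)].
have leF' : #|F'| <= ex_turan k.+1 (n - t) (linear_star k.+1 p).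
  apply: (turan_relabel (T := T)).
  - by apply/forall_inP => D; rewrite inE => /andP[DF _]; apply: (forall_inP unifF).
  - apply/negP => con.
    have wEa : w \notin Ea by move: Eaq; rewrite qH inE => /andP[].
    have [|D DF|h [P [/andP[spP cP] injh embh sP]]] := star_embedding (good := fun P => sparse k T Ms P && (#|P| <= k))
      k0 copy D0w (fun D Dw => (inHw D Dw).2) (subsetIl _ Ea) _ cardA single _ con.
    + by rewrite inE negb_and wEa orbT.
    + move: DF; rewrite inE => /and3P[DF dT]; rewrite inE DF dT /=.
      case/forall_inPn => u uD /forall_inPn[v vD]; rewrite negb_imply => /andP[uv nG].
      have c2 : #|[set u; v]| = 2 by rewrite cards2 uv.
      have sD : [set u; v] \subset D by rewrite subUset !sub1set uD vD.
      exists [set u; v]; split=> //; move: nG; rewrite inE c2 eqxx (disjointWl sD dT) /=.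
      by rewrite negbK k2 andbT.
    (* The sparse set [P] grows to a sparse $k$-set [B], on which [attach_star] hangs the edges
       avoiding [w]. *)
    have [B BS PB] := sparse_sub_sets k0 cT Msk nlargeX spP cP.
    case/negP: noH.
    have embF E : E \in edges_at H w -> h @: E \in F /\ [disjoint h @: E & T].
      by move/embh; rewrite inE => /and3P[].
    apply: (attach_star (X := 'I_n) unifH cutS wS cardS tq size_q qH D0w Eaq attach (F := F)
      _ cT (sparse_clean k0 cT Msk nlargeX) _ _ injh _ _ BS).
    + by rewrite card_ord.
    + by move=> C; rewrite inE => /andP[_ /sparseP[]].
    + move=> C x CS xT; have := sparse_sets_notin CS; rewrite inE.
      move: CS; rewrite inE => /andP[-> /sparseP[-> _]] /=.
      by rewrite negbK => /forall_inP; apply.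
    + by move=> E /embF[].
    + move=> v /coverP[E /embF[_ dE] vE]; rewrite (disjointFr dE) // imset_f //.
    + exact: subset_trans sP PB.
  - by move=> D; rewrite inE => /and3P[].
  - by rewrite card_ord cT.
have leDD : #|DD| <= #|Mi|.
  have unifD D : D \in DD -> #|D| = k.+1.
    by rewrite inE => /andP[DF _]; apply/eqP/(forall_inP unifF).
  have pairsD D u v : D \in DD -> u \in D -> v \in D -> u != v -> [set u; v] \in G.
    rewrite inE => /and3P[_ _ /forall_inP h] uD vD uv.
    by move/forall_inP/(_ v vD)/implyP: (h u uD); apply.
  have sh : #|DD| <= N * #|shadow DD|.
    rewrite leqNgt; apply/negP => lt; have [us sH _] := treeH.
    have rH : rev s =i H by move=> E; rewrite mem_rev sH.
    have sz : size s = #|H| by rewrite -(card_uniqP us) (eq_card sH).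
    have H0 : rev s != [::].
      apply: contraTneq (proj1 (inHw D0 D0w)) => s0; by rewrite -rH s0.
    have [||f [injf embf]] := tree_turan (ltn0Sn k) unifD (tree_ordering_seq treeH) H0.
    - by move=> E; rewrite rH => EH; apply/eqP/(forall_inP unifH).
    - apply: leq_ltn_trans lt; rewrite leq_mul2r size_rev sz leq_mul2l ltnS.
      by rewrite (leqW (leqnSn _)) !orbT.
    case/negP: noH; apply: (@contains_embedding _ _ _ _ f); first by rewrite card_ord.
      move=> u v /coverP[E EH uE] /coverP[D DH vD]; apply: injf; apply/cover_seqP.
        by exists E; rewrite ?rH.
      by exists D; rewrite ?rH.
    move=> E; rewrite -rH => /embf; by rewrite inE => /andP[].
  have tri := card_shadow_triangles k3 unifD pairsD.
  have := @card_triangles _ G d; rewrite card_ord => /(_ n_gt0) tri2.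
  rewrite card_ord in tri.
  have adj := card_adj_pairs G2.
  apply: (final_arith (n := n) (E := n ^ (k - 3)) (c := c) (d := d) (e := e) (N := N)
    (a := #|adj_pairs G|) (tri := #|triangles G|)) => //.
  - by rewrite expn_gt0 n_gt0.
  - by rewrite /e ltnS leq_addr.
  - have -> : n * n ^ (k - 3) = n ^ (k - 2) by rewrite -expnS; congr (_ ^ _); move: (k3); clear; lia.
    apply: (@leq_trans (#|G| * 4 * n ^ (k - 2))); first by rewrite leq_mul2r adj orbT.
    rewrite mulnAC mulnC /c -mulnA leq_mul2l /=; apply: leq_trans cG _.
    by rewrite leq_mul2l leMs orbT.
  - apply: leq_trans leMi _; rewrite -!mulnA -!expnS leq_pexp2l //; move: (k3); clear; lia.
  - by apply: leq_trans sh _; rewrite leq_mul2l tri orbT.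
have cF : #|F| <= #|[set D in F | ~~ [disjoint D & T]]| + #|F'| + #|DD|.
  have sub : F \subset [set D in F | ~~ [disjoint D & T]] :|: F' :|: DD.
    apply/subsetP => D DF; rewrite !in_setU; have [//|DDD] := boolP (D \in DD).
      by rewrite orbT.
    have [dT|dT] := boolP [disjoint D & T].
      by rewrite [D \in F']inE DF dT DDD orbT.
    by rewrite [D \in [set D in F | _]]inE DF dT.
  apply: leq_trans (subset_leq_card sub) _; rewrite cardsU; apply: leq_trans (leq_subr _ _) _.
  by rewrite leq_add2r cardsU leq_subr.
(* The $r$-sets meeting [T] are either edges of [F] or members of [Mi], so the bound for [DD] is
   paid here. *)
have cM : #|[set D in F | ~~ [disjoint D & T]]| + #|Mi| <= 'C(n, k.+1) - 'C(n - t, k.+1).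
  have := card_meeting T k.+1; rewrite card_ord cT => <-.
  rewrite -[leqRHS](cardsID F); apply: leq_add; apply: subset_leq_card; apply/subsetP => D.
    by rewrite !inE => /andP[DF ->]; rewrite DF (forall_inP unifF D DF).
  by rewrite !inE => /and3P[-> -> ->].
move: leF' leDD cF cM; move: #|F| #|F'| #|DD| #|Mi| #|_| => x1 x2 x3 x4 x5.
move: (ex_turan _ _ _) ('C(n, _) - _); clear; lia.
Qed.

End Final.

(** [g] inverts the renaming [f], with [o] as default value off its image. *)
Lemma contains_copy (U W X : finType) (G : {set {set W}}) (H : {set {set U}})
    (F : {set {set X}}) (o : W) :
  #|U| <= #|X| -> is_copy G H -> contains G F -> contains H F.
Proof.
move=> UX [f injf ->] /existsP[h /andP[/injectiveP injh /forall_inP emb]].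
pose g x := odflt o [pick y | f y == x].
have gK y : g (f y) = y.
  by rewrite /g; case: pickP => [z /eqP/injf->//|/(_ y)]; rewrite eqxx.
apply: (@contains_embedding _ _ _ _ (h \o g)) => //.
  move=> u v /coverP[_ /imsetP[E _ ->] /imsetP[x _ ->]].
  by move=> /coverP[_ /imsetP[E' _ ->] /imsetP[y _ ->]]; rewrite /= !gK => /injh->.
move=> _ /imsetP[E EG ->]; rewrite -imset_comp (_ : _ @: E = h @: E) ?emb //.
by apply: eq_imset => x; rewrite /= gK.
Qed.

Theorem theorem4p5 (r t p : nat) (V : finType) (H : {set {set V}})
    (s : seq {set V}) (S : {set V}) (w : V) :
  4 <= r ->
  is_rtree r H ->
  reducible (r - 2) H ->
  sigma H = t.+1 ->
  tree_ordering H s ->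
  min_cross_cut H S ->
  included_last s S w ->
  is_copy (linear_star r p) (edges_at H w) ->
  exists n1 : nat, 0 < n1 /\
    forall n : nat, n1 <= n ->
      ex_turan r n H <= 'C(n, r) - 'C(n - t, r) + ex_turan r (n - t) (linear_star r p).
Proof.
move=> r4 [unif _] red sig tree mS last copy.
have [cut /eqP cS] := andP mS; rewrite sig in cS.
(* [star_attachment] needs a point of [S] besides [w], hence the separate case [t = 0]. *)
case: t sig cS => [|t] sig cS; last first.
  case: r r4 unif red copy => // k k3 unif red copy.
  have [q [D0 [Ea [[tq sq qH] [D0w Eaq att cA sing]]]]] :=
    star_attachment (leq_trans (isT : 2 <= 4) k3) unif red tree mS last cS copy.
  exact: (turan_bound k3 unif red tree cut (proj1 last) cS tq sq qH D0w Eaq att cA sing copy).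
(* For [t = 0] the cross-cut is [w] alone, so every edge contains [w] and [H] is itself a copy of
   the star. *)
exists #|V|.+1; split=> // n nV; rewrite !subn0 subnn add0n.
have eH : edges_at H w = H.
  apply/setP => E; rewrite inE; case EH: (E \in H) => //=.
  have [v vS vE] := cross_cut_ex cut EH.
  move/eqP/cards1P: cS => [x eS]; have := proj1 last.
  by move: vS; rewrite eS !inE => /eqP <- /eqP ->.
rewrite eH in copy; apply/bigmax_leqP => F /andP[unifF noH].
apply: (@leq_bigmax_cond _ _ _ F); rewrite unifF.
apply: contra noH; apply: contains_copy copy; first exact: None.
by rewrite card_ord ltnW.
Qed.
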